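(* Let $D_k\in\mathcal A_k^{\mathrm{NS}}$ be generated by finite-energy normalized data $(u_k,p_k)$ satisfying the local energy inequality on the normalized window $Q_1$. Let $0<\lambda<1$ and $$u_{k+1}(Y,S)=\lambda u_k(\lambda Y,\lambda^2S),\qquad p_{k+1}(Y,S)=\lambda^2p_k(\lambda Y,\lambda^2S).$$ Then there is a constant $C_{\lambda,\chi,\theta}$, depending only on $\lambda,\chi,\theta$, such that $$\mathsf{Leak}_\phi^{\mathrm{EF}}(u_{k+1},p_{k+1})\le C_{\lambda,\chi,\theta}\,\mathsf{Leak}_{k\to k+1}^{\mathrm{EF}}.$$ Consequently the localization component is admissible (i.e. the energy/flux localization terms created by restriction and rescaling are dominated by the ledger entry $\Delta_k^{\mathrm{loc},\mathrm{EF}}$) whenever $\Delta_k^{\mathrm{loc},\mathrm{EF}}\ge C_{\lambda,\chi,\theta}\mathsf{Leak}_{k\to k+1}^{\mathrm{EF}}$.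
   Context: $B_1\subset\mathbb R^3$ is the unit ball, $Q_1=B_1\times(-1,0)$. Being generated by data of class $\mathcal A_k^{\mathrm{NS}}$ means: $u_k\in L^3(Q_1)^3\cap L^\infty((-1,0);L^2(B_1))^3$, $\nabla u_k\in L^2(Q_1)^{3\times3}$, $p_k\in L^{3/2}(Q_1)$, $-\Delta p_k=\partial_i\partial_j(u_{k,i}u_{k,j})$ in distributions modulo time-dependent constants, the local energy inequality of suitable weak solutions on $Q_1$, and finite audit bookkeeping coordinates. Cutoffs: $\chi\in C_c^\infty(B_1)$ with $\chi\equiv1$ on $B_{3/4}$, $\theta\in C_c^\infty((-1,0])$, $\phi(y,s)=\theta(s)\chi(y)$, $\Omega_\chi=\operatorname{supp}\chi$, $A_\chi=\operatorname{supp}\nabla\chi\cup\operatorname{supp}\Delta\chi$. Leakages: $$\mathsf{Leak}_\phi^{\mathrm{EF}}(u,p)=\int_{Q_1}|u|^2(|\partial_t\phi|+|\Delta\phi|)+\int_{Q_1}(|u|^3+2|p||u|)|\nabla\phi|+2\int_{Q_1}|\nabla u|^2\phi,$$ $$\mathsf{Leak}_{k\to k+1}^{\mathrm{EF}}=\int_{-\lambda^2}^0\int_{\lambda\Omega_\chi}(|u_k|^2+|\nabla u_k|^2)+\int_{-\lambda^2}^0\int_{\lambda A_\chi}(|u_k|^2+|u_k|^3+|p_k||u_k|).$$ *)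

(* Defs.v *)
From HB Require Import structures.
From mathcomp Require Import all_boot all_order all_algebra.
From mathcomp Require Import all_classical all_reals all_analysis.
From mathcomp Require Import ess_sup_inf.

Set Implicit Arguments.
Unset Strict Implicit.
Unset Printing Implicit Defensive.
Import Order.TTheory GRing.Theory Num.Theory.
Import numFieldNormedType.Exports.

Local Open Scope classical_set_scope.
Local Open Scope ring_scope.

(* R^3 and R^3 x R are iterated products, on which the library provides the
   product topology, the Borel sigma-algebra and product measures.  The norm of
   these products is the sup norm, so Euclidean norms are written out below.
   Plain notations keep the canonical structures visible. *)
Notation space3 R := (R * R * R)%type.
Notation spacetime R := ((R * R * R) * R)%type.

Notation borel3 R :=
  (measurableTypeR R * measurableTypeR R * measurableTypeR R)%type.
Notation borel31 R :=
  (measurableTypeR R * measurableTypeR R * measurableTypeR R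
   * measurableTypeR R)%type.

(* A vector (matrix) field is the family of its components. *)
Notation scalar_field R := (spacetime R -> R).
Notation vector_field R := ('I_3 -> spacetime R -> R).
Notation tensor_field R := ('I_3 -> 'I_3 -> spacetime R -> R).

Section Geometry.
Variable R : realType.

(* The library's lebesgue_measure lives on measurableTypeR R, the carrier R with
   its Borel sigma-algebra. *)
Definition leb1 : {measure set (measurableTypeR R) -> \bar R} :=
  @lebesgue_measure R.
Definition leb3 : {measure set borel3 R -> \bar R} :=
  (@lebesgue_measure R \x @lebesgue_measure R \x @lebesgue_measure R)%E.
Definition leb31 : {measure set borel31 R -> \bar R} :=
  (leb3 \x @lebesgue_measure R)%E.

Definition coord (y : space3 R) (i : 'I_3) : R :=
  tnth [tuple y.1.1; y.1.2; y.2] i.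

Definition basis3 (i : 'I_3) : space3 R :=
  (((i == 0%N :> nat)%:R, (i == 1%N :> nat)%:R), (i == 2%N :> nat)%:R).

Definition enorm (v : 'I_3 -> R) : R := Num.sqrt (\sum_(i < 3) v i ^+ 2).

Definition eball (r : R) : set (space3 R) := [set y | enorm (coord y) < r].

Definition Q1 : set (spacetime R) := eball 1 `*` `]-1, 0[.

Definition dil (lambda : R) (A : set (space3 R)) : set (space3 R) :=
  [set lambda *: y | y in A].

End Geometry.

Section Smooth.
Variables (R : realType).

Fixpoint Cn (V : normedModType R) (n : nat) (f : V -> R) : Prop :=
  continuous f /\
  (if n is m.+1 then
     (forall x v : V, derivable f x v) /\
     (forall v : V, Cn m (fun x => 'D_v f x))
   else True).

Definition smooth (V : normedModType R) (f : V -> R) : Prop :=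
  forall n, Cn n f.

Definition supp (V : normedModType R) (f : V -> R) : set V :=
  closure [set x | f x != 0].

Definition Ccinfty (V : normedModType R) (U : set V) (f : V -> R) : Prop :=
  [/\ smooth f, compact (supp f) & supp f `<=` U].

(* C_c^oo((-1, 0]): the restrictions to (-1, 0] of smooth functions on R, with
   support compact in (-1, 0], hence away from -1 but possibly containing 0.
   The values of theta outside (-1, 0] play no role. *)
Definition Ccinfty_time (theta : R -> R) : Prop :=
  let K := closure [set s | s \in `]-1, 0] /\ theta s != 0] in
  [/\ smooth theta, compact K & K `<=` `]-1, 0]].

Definition grad3 (f : space3 R -> R) (y : space3 R) (i : 'I_3) : R :=
  'D_(basis3 R i) f y.

Definition lap3 (f : space3 R -> R) (y : space3 R) : R :=
  \sum_(i < 3) 'D_(basis3 R i) (fun y' => grad3 f y' i) y.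

Definition dx (i : 'I_3) (f : scalar_field R) (z : spacetime R) : R :=
  'D_((basis3 R i, 0) : spacetime R) f z.

Definition dt (f : scalar_field R) (z : spacetime R) : R :=
  'D_((0, 1) : spacetime R) f z.

Definition lapx (f : scalar_field R) (z : spacetime R) : R :=
  \sum_(i < 3) dx i (dx i f) z.

End Smooth.

Section Fields.
Variable R : realType.
Implicit Types (u : vector_field R) (p f : scalar_field R) (G : tensor_field R).

Definition Lp_on d (T : measurableType d) (mu : {measure set T -> \bar R})
    (D : set T) (q : R) (f : T -> R) : Prop :=
  (f \_ D) \in Lfun mu q%:E.

Definition vnorm u (z : spacetime R) : R := enorm (fun i => u i z).

Definition tnormsq G (z : spacetime R) : R :=
  \sum_(i < 3) \sum_(j < 3) G i j z ^+ 2.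

Definition locally_integrable_on (D : set (spacetime R)) f : Prop :=
  measurable_fun (D : set (borel31 R)) f /\
  forall K, compact K -> K `<=` D ->
    (\int[leb31 R]_(z in K) `|f z|%:E < +oo)%E.

Definition is_weak_dx (D : set (spacetime R)) (j : 'I_3) f g : Prop :=
  [/\ locally_integrable_on D f, locally_integrable_on D g &
   forall psi : scalar_field R, Ccinfty D psi ->
     (\int[leb31 R]_(z in D) (f z * dx j psi z)) =
     - (\int[leb31 R]_(z in D) (g z * psi z))].

Definition is_weak_grad (D : set (spacetime R)) u G : Prop :=
  forall i j, is_weak_dx D j (u i) (G i j).

(* The weak gradient on Q_1 is unique up to a null set when it exists; a
   representative is chosen, and 0 is the dummy value otherwise. *)
Definition weak_grad u : tensor_field R :=
  xget (fun _ _ _ => 0) [set G | is_weak_grad (@Q1 R) u G].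

(* sup over a.e. s in (-1,0) of the squared L^2(B_1) norm is finite. *)
Definition LinftyL2 u : Prop :=
  (ess_sup (leb1 R)
    ((fun s : R => \int[leb3 R]_(y in eball 1) (vnorm u (y, s) ^+ 2)%:E)
       \_ `](-1)%R, 0%R[%classic) < +oo)%E.

(* - Delta p = d_i d_j (u_i u_j) in D'(Q_1), p being given modulo functions of
   time only. *)
Definition pressure_eq u p : Prop :=
  exists c : R -> R, Lp_on (leb1 R) `]-1, 0[ (3 / 2) c /\
  forall psi : scalar_field R, Ccinfty (@Q1 R) psi ->
    - (\int[leb31 R]_(z in @Q1 R) ((p z - c z.2) * lapx psi z)) =
    \int[leb31 R]_(z in @Q1 R)
      (\sum_(i < 3) \sum_(j < 3) u i z * u j z * dx i (dx j psi) z).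

(* Caffarelli-Kohn-Nirenberg form, unit viscosity and no force. *)
Definition local_energy_ineq u p : Prop :=
  forall psi : scalar_field R, Ccinfty (@Q1 R) psi -> (forall z, 0 <= psi z) ->
    2 * (\int[leb31 R]_(z in @Q1 R) (tnormsq (weak_grad u) z * psi z)) <=
    \int[leb31 R]_(z in @Q1 R)
      (vnorm u z ^+ 2 * (dt psi z + lapx psi z) +
       (vnorm u z ^+ 2 + 2 * p z) * \sum_(i < 3) u i z * dx i psi z).

(* The audit bookkeeping attached to a datum: the localization entry
   Delta^{loc,EF} and further coordinates indexed by an arbitrary type. *)
Record audit_ledger (I : Type) := AuditLedger {
  Delta_loc : \bar R;
  audit_coord : I -> \bar R
}.

Definition ANS (I : Type) u p (D : audit_ledger I) : Prop :=
  [/\ (forall i, Lp_on (leb31 R) (@Q1 R) 3 (u i)) /\ LinftyL2 u,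
      (exists G, is_weak_grad (@Q1 R) u G) /\
      (forall i j, Lp_on (leb31 R) (@Q1 R) 2 (weak_grad u i j)),
      Lp_on (leb31 R) (@Q1 R) (3 / 2) p /\ pressure_eq u p,
      local_energy_ineq u p &
      Delta_loc D \is a fin_num /\
      (forall a, audit_coord D a \is a fin_num)].

End Fields.

Section Leakage.
Variable R : realType.
Implicit Types (u : vector_field R) (p phi : scalar_field R).
Implicit Types (lambda : R) (chi : space3 R -> R) (theta : R -> R).

Definition cutoff chi theta : scalar_field R := fun z => theta z.2 * chi z.1.

Definition Omega_cut chi : set (space3 R) := supp chi.

Definition A_cut chi : set (space3 R) :=
  closure [set y | exists i, grad3 chi y i != 0] `|` supp (lap3 chi).

Local Open Scope ereal_scope.

Definition Leak_phi phi u p : \bar R :=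
  (\int[leb31 R]_(z in @Q1 R)
     (vnorm u z ^+ 2 * (`|dt phi z| + `|lapx phi z|))%:E) +
  (\int[leb31 R]_(z in @Q1 R)
     ((vnorm u z ^+ 3 + 2 * `|p z| * vnorm u z)
        * enorm (fun i => dx i phi z))%:E) +
  2%:E * (\int[leb31 R]_(z in @Q1 R) (tnormsq (weak_grad u) z * phi z)%:E).

Definition Leak_step lambda chi u p : \bar R :=
  (\int[leb1 R]_(s in `](- lambda ^+ 2)%R, 0%R[)
     \int[leb3 R]_(y in dil lambda (Omega_cut chi))
       (vnorm u (y, s) ^+ 2 + tnormsq (weak_grad u) (y, s))%:E) +
  (\int[leb1 R]_(s in `](- lambda ^+ 2)%R, 0%R[)
     \int[leb3 R]_(y in dil lambda (A_cut chi))
       (vnorm u (y, s) ^+ 2 + vnorm u (y, s) ^+ 3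
          + `|p (y, s)| * vnorm u (y, s))%:E).

Definition is_rescaling lambda u p (u' : vector_field R) (p' : scalar_field R)
    : Prop :=
  forall Y S, @Q1 R (Y, S) ->
    (forall i, u' i (Y, S) = lambda * u i (lambda *: Y, lambda ^+ 2 * S))%R /\
    (p' (Y, S) = lambda ^+ 2 * p (lambda *: Y, lambda ^+ 2 * S))%R.

Definition loc_admissible (I : Type) phi (D : audit_ledger R I) u' p' : Prop :=
  Leak_phi phi u' p' <= Delta_loc D.

End Leakage.

(* Main.v *)
From HB Require Import structures.
Require Import Defs.
From mathcomp Require Import all_boot all_order all_algebra.
From mathcomp Require Import all_classical all_reals all_analysis.
From mathcomp Require Import ring lra measurable_realfun.
Set Implicit Arguments.
Unset Strict Implicit.
Unset Printing Implicit Defensive.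
Import Order.TTheory GRing.Theory Num.Theory.
Import numFieldNormedType.Exports.
Local Open Scope classical_set_scope.
Local Open Scope ring_scope.

(* After the parabolic change of variables T (y, s) = (lambda y, lambda^2 s),
   of Jacobian lambda^5, the bound is a pointwise one: the space derivatives of
   the cutoff vanish off A_chi, the cutoff and its time derivative vanish off
   Omega_chi, and all of them are bounded.  The one delicate point is that
   weak_grad u_{k+1} is an arbitrarily chosen representative: the chain rule
   only says that lambda^2 (weak_grad u_k o T) is a weak gradient of u_{k+1}, so
   that a.e. uniqueness of weak derivatives is needed.  It follows from the
   lemma of du Bois-Reymond, whose test functions are products of the bumps
   g(m (x - a)) g(m (b - x)) with g(x) = exp(-1/x) for x > 0: since
   g(m x) = g(x)^(1/m), these tend to the indicator function of the box. *)

(** * Lebesgue measure and parabolic scaling *)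

(** The constant is [K * lambda ^- 5]: the power of lambda undoes the Jacobian, and [K], fixed
    before the fields, collects bounds of the cutoff and its derivatives on [Q1]. Rescaling also
    multiplies |u|^2, |u|^3, |p||u| and |grad u|^2 by lambda^2, lambda^3, lambda^3 and lambda^4;
    being at most 1, these factors are simply dropped. The comparison is between extended integrals
    of nonnegative functions, so it makes sense even if a leakage is infinite. Only the gradient
    term of [Leak_phi] is signed, because the cutoff is; it is bounded by the integral of its
    absolute value. Box indicators suffice for uniqueness by measure theory: boxes form a pi-system
    generating the sigma-algebra, so an integrable function whose integrals over boxes all vanish
    integrates to 0 over every measurable set, hence is 0 almost everywhere. Bounded pointwise
    limits of test functions are all that this takes, and no convolution enters. *)

Definition image_measure d1 d2 (T1 : measurableType d1)
    (T2 : measurableType d2) (R : realType) (m : {measure set T1 -> \bar R})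
    (f : T1 -> T2) (mf : measurable_fun setT f) : {measure set T2 -> \bar R}.
Proof. by refine (pushforward m f). Defined.

(** The hypothesis makes [m] equal to [a] times its own image under [h]; the integral against this
    scaled pushforward is then unfolded. *)
Lemma ge0_integral_image_measure d (T : measurableType d) (R : realType)
    (m : {measure set T -> \bar R}) (a : R) (a0 : 0 <= a) (h : T -> T)
    (mh : measurable_fun setT h) :
  (forall A, measurable A -> m A = a%:E * m (h @^-1` A))%E ->
  forall (D : set T) (f : T -> \bar R),
    measurable D -> measurable_fun D f -> (forall z, D z -> 0 <= f z)%E ->
  (\int[m]_(z in D) f z = a%:E * \int[m]_(z in h @^-1` D) f (h z))%E.
Proof.
move=> mE D f mD mf f0.
rewrite (@eq_measure_integral _ _ _ _ (mscale (NngNum a0) (image_measure m mh)));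
    last first.
  by move=> A mA _; rewrite mE.
rewrite ge0_integral_mscale//; congr *%E.
apply: ge0_integral_pushforward => //.
by move=> y /[!inE]; exact: f0.
Qed.

(** By uniqueness of Lebesgue measure, it is enough that the scaled image measure gives half-open
    intervals their length. *)
Lemma lebesgue_measure_dilation (R : realType) (c : R) (c0 : 0 < c)
    (A : set (measurableTypeR R)) : measurable A ->
  (@lebesgue_measure R A =
   c%:E * @lebesgue_measure R (( *%R c) @^-1` A))%E.
Proof.
move=> mA.
have mc : measurable_fun [set: measurableTypeR R]
    (( *%R c) : measurableTypeR R -> measurableTypeR R).
  exact: mulrl_measurable.
rewrite (@lebesgue_measure_unique R
  (mscale (NngNum (ltW c0)) (image_measure (@lebesgue_measure R) mc))) // => X
      [[a b] /= _ <-].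
rewrite /= /mscale /= /pushforward.
have -> : ( *%R c) @^-1` `]a, b]%classic = `]c^-1 * a, c^-1 * b]%classic.
  apply/seteqP; split => x /=; rewrite !in_itv /=;
   by rewrite ltr_pdivrMl ?ler_pdivlMl ?invr_gt0.
rewrite !lebesgue_measure_itv /= !lte_fin ltr_pM2l ?invr_gt0//.
case: ifPn => ab; last by rewrite mule0.
by rewrite -!EFinB -EFinM -mulrBr mulVKf ?gt_eqF.
Qed.

Section product_dilation.
Context d1 d2 (T1 : measurableType d1) (T2 : measurableType d2) (R : realType).
Variable m1 : {sigma_finite_measure set T1 -> \bar R}.
Variable m2 : {sigma_finite_measure set T2 -> \bar R}.
Variables (f : T1 -> T1) (g : T2 -> T2) (a b : R).
Hypotheses (a0 : 0 <= a) (b0 : 0 <= b).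
Hypothesis mf : measurable_fun setT f.
Hypothesis mg : measurable_fun setT g.

(** Both sides are measures in [C] that agree on rectangles, where the two factors multiply;
    uniqueness of the product measure concludes. *)
Lemma product_measure_dilation :
  (forall A, measurable A -> m1 A = (a%:E * m1 (f @^-1` A))%E) ->
  (forall B, measurable B -> m2 B = (b%:E * m2 (g @^-1` B))%E) ->
  forall C, measurable C -> (m1 \x m2)%E C =
    ((a * b)%:E * (m1 \x m2) ((fun z => (f z.1, g z.2)) @^-1` C))%E.
Proof.
move=> fA gB C mC.
have mh : measurable_fun [set: T1 * T2] (fun z => (f z.1, g z.2)).
  by apply: measurable_fun_pair; apply: measurableT_comp.
rewrite (@product_measure_unique _ _ _ _ _ m1 m2
  (mscale (NngNum (mulr_ge0 a0 b0)) (image_measure (m1 \x m2)%E mh))) // => A B mA mB.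
rewrite /= /mscale /= /pushforward.
have mfA : measurable (f @^-1` A) by rewrite -[X in measurable X]setTI; exact: mf.
have mgB : measurable (g @^-1` B) by rewrite -[X in measurable X]setTI; exact: mg.
change (((a * b)%:E * (m1 \x m2) ((f @^-1` A) `*` (g @^-1` B)) = m1 A * m2 B)%E).
by rewrite product_measure1E // (fA A) // (gB B)// muleACA EFinM.
Qed.

End product_dilation.

(* The library keeps the sigma-finite structure on product measures local; this
   alias carries it, for Tonelli and for the uniqueness of products. *)
Section product_sigma_finite.
Context d1 d2 (T1 : measurableType d1) (T2 : measurableType d2) (R : realType).
Variable m1 : {sigma_finite_measure set T1 -> \bar R}.
Variable m2 : {sigma_finite_measure set T2 -> \bar R}.

Lemma sigma_finite_product_measure : sigma_finite setT (m1 \x m2)%E.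
Proof.
have /sigma_finiteP[F [TF ndF Foo]] := sigma_finiteT m1.
have /sigma_finiteP[G [TG ndG Goo]] := sigma_finiteT m2.
exists (fun n => F n `*` G n) => [|k].
  rewrite -setXTT TF TG; apply/seteqP; split => -[x y].
    move=> [[n _ Fnx] [k _ Gky]]; exists (maxn n k) => //; split.
      exact: (subsetPset _ _ (ndF _ _ (leq_maxl n k))).
    exact: (subsetPset _ _ (ndG _ _ (leq_maxr n k))).
  by move=> [n _ [? ?]]; split; exists n.
have [? ?] := Foo k; have [? ?] := Goo k; split; first exact: measurableX.
by rewrite product_measure1E// lte_mul_pinfty// ge0_fin_numE.
Qed.

Definition product_sigma_finite_measure :=
  (m1 \x m2 : set (T1 * T2)%type -> \bar R)%E.
HB.instance Definition _ := Measure.on product_sigma_finite_measure.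
HB.instance Definition _ := Measure_isSigmaFinite.Build _ _ _
  product_sigma_finite_measure sigma_finite_product_measure.

End product_sigma_finite.

Definition parabolic (R : realType) (c : R) (z : spacetime R) : spacetime R :=
  (c *: z.1, c ^+ 2 * z.2).

Section parabolic.
Variables (R : realType) (c : R).
Hypothesis c0 : 0 < c.
Local Notation T := (parabolic c : borel31 R -> borel31 R).

Lemma measurable_scale3 : measurable_fun [set: borel3 R]
  ((fun y => c *: y) : borel3 R -> borel3 R).
Proof.
have m1 : measurable_fun [set: measurableTypeR R]
    (( *%R c) : measurableTypeR R -> measurableTypeR R) by exact: mulrl_measurable.
apply: measurable_fun_pair; last exact: (measurableT_comp m1 measurable_snd).
apply: measurable_fun_pair.
  exact: (measurableT_comp m1 (measurableT_comp measurable_fst measurable_fst)).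
exact: (measurableT_comp m1 (measurableT_comp measurable_snd measurable_fst)).
Qed.

Lemma measurable_parabolic : measurable_fun setT T.
Proof.
have m1 : measurable_fun [set: measurableTypeR R]
    (( *%R (c ^+ 2)) : measurableTypeR R ->
        measurableTypeR R) by exact: mulrl_measurable.
apply: measurable_fun_pair; last exact: (measurableT_comp m1 measurable_snd).
exact: (measurableT_comp measurable_scale3 measurable_fst).
Qed.

Lemma leb3_dilation (A : set (borel3 R)) : measurable A ->
  (leb3 R A = (c ^+ 3)%:E * leb3 R ((fun y => c *: y) @^-1` A))%E.
Proof.
move=> mA.
have m1 : measurable_fun [set: measurableTypeR R]
    (( *%R c) : measurableTypeR R -> measurableTypeR R) by exact: mulrl_measurable.
have l1 := @lebesgue_measure_dilation R c c0.
have m2 : measurable_fun [set: measurableTypeR R * measurableTypeR R]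
   (fun z => (c * z.1 : measurableTypeR R, c * z.2 : measurableTypeR R)).
  by apply: measurable_fun_pair; apply: measurableT_comp.
have c1 := ltW c0.
have l2 := product_measure_dilation c1 c1 m1 m1 l1 l1.
have l3 := @product_measure_dilation _ _ _ _ _ (product_sigma_finite_measure
    (@lebesgue_measure R) (@lebesgue_measure R))
  (@lebesgue_measure R) _ _ _ _ (mulr_ge0 c1 c1) c1 m2 m1 l2 l1.
by rewrite [LHS]l3//=; congr (_%:E * _)%E; rewrite !exprS expr0 mulr1 mulrA.
Qed.

(** The exponent is 3 + 2: three space directions of weight 1, and time of weight 2. *)
Lemma leb31_parabolic (A : set (borel31 R)) : measurable A ->
  (leb31 R A = (c ^+ 5)%:E * leb31 R (T @^-1` A))%E.
Proof.
move=> mA.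
have l1 := @lebesgue_measure_dilation R (c ^+ 2) (exprn_gt0 2 c0).
have m1 : measurable_fun [set: measurableTypeR R]
    (( *%R (c ^+ 2)) : measurableTypeR R ->
        measurableTypeR R) by exact: mulrl_measurable.
have l4 := @product_measure_dilation _ _ _ _ _ 
  (product_sigma_finite_measure (product_sigma_finite_measure (@lebesgue_measure
      R) (@lebesgue_measure R)) (@lebesgue_measure R))
  (@lebesgue_measure R) _ _ (c ^+ 3) (c ^+ 2) (exprn_ge0 3 (ltW c0)) (exprn_ge0 2
      (ltW c0))
  measurable_scale3 m1 leb3_dilation l1.
by rewrite [LHS]l4//=; congr (_%:E * _)%E; rewrite -exprD.
Qed.

Lemma ge0_integral_parabolic (D : set (borel31 R)) (f : borel31 R -> \bar R) :
  measurable D -> measurable_fun D f -> (forall z, D z -> 0 <= f z)%E ->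
  (\int[leb31 R]_(z in D) f z =
   (c ^+ 5)%:E * \int[leb31 R]_(z in T @^-1` D) f (T z))%E.
Proof.
exact: (ge0_integral_image_measure (exprn_ge0 5 (ltW c0)) measurable_parabolic
    leb31_parabolic).
Qed.

(** Non-integrable [f] are covered too: multiplication by c^5 > 0 commutes with extended
    subtraction, even of infinities, and [fine] sends infinite values to 0 on both sides. *)
Lemma Rintegral_parabolic (D : set (borel31 R)) (f : borel31 R -> R) :
  measurable D -> measurable_fun D f ->
  \int[leb31 R]_(z in D) f z =
  c ^+ 5 * \int[leb31 R]_(z in T @^-1` D) f (T z).
Proof.
move=> mD mf.
have mEf : measurable_fun D (EFin \o f) by exact/measurable_EFinP.
rewrite /Rintegral integralE (ge0_integral_parabolic mD)//;
    last exact: measurable_funepos.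
rewrite (ge0_integral_parabolic mD)//; last exact: measurable_funeneg.
rewrite [in RHS]integralE.
have c5 : 0 < c ^+ 5 by rewrite exprn_gt0.
suff key (x y : \bar R) : fine ((c ^+ 5)%:E * x - (c ^+ 5)%:E * y)%E =
    c ^+ 5 * fine (x - y)%E.
  rewrite key; congr (_ * fine (_ - _)%E); apply: eq_integral => z _.
    exact: (congr1 (@^~ z) (esym (funepos_comp (EFin \o f) T))).
  exact: (congr1 (@^~ z) (esym (funeneg_comp (EFin \o f) T))).

have -> : ((c ^+ 5)%:E * x - (c ^+ 5)%:E * y = (c ^+ 5)%:E * (x - y))%E.
  by move: x y => [x||] [y||];
      rewrite /= ?gt0_muley ?gt0_muleNy ?lte_fin// -!EFinM -?EFinB ?mulrBr.
by case: (x - y)%E => [w||] //=; rewrite ?gt0_muley ?gt0_muleNy ?lte_fin//= mulr0.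
Qed.

End parabolic.

(** * Smooth bumps *)

Section Cn_theory.
Context {R : realType}.
Implicit Types V W : normedModType R.

Lemma CnS V n (f : V -> R) : Cn n.+1 f -> Cn n f.
Proof.
elim: n f => [|n IH] f [cf [df Df]]; first by [].
by split => //; split => // v; exact/IH/Df.
Qed.

Lemma Cn_ext V n (f g : V -> R) : f =1 g -> Cn n f -> Cn n g.
Proof. by move=> /funext ->. Qed.

Lemma CnD V n (f g : V -> R) : Cn n f -> Cn n g -> Cn n (fun x => f x + g x).
Proof.
elim: n f g => [|n IH] f g [cf Hf] [cg Hg].
  by split => // x; apply: cvgD; [exact: cf|exact: cg].
split; first by move=> x; apply: cvgD; [exact: cf|exact: cg].
case: Hf => df Df; case: Hg => dg Dg; split => [x v|v].
  exact: derivableD.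
apply: Cn_ext (IH _ _ (Df v) (Dg v)) => x.
by rewrite -[LHS]deriveD.
Qed.

(** Leibniz's rule pairs a derivative of one factor with the other factor itself, which [CnS] brings
    down to the order of the induction hypothesis. *)
Lemma CnM V n (f g : V -> R) : Cn n f -> Cn n g -> Cn n (fun x => f x * g x).
Proof.
elim: n f g => [|n IH] f g Hf Hg.
  split => // x; apply: cvgM; [exact: Hf.1|exact: Hg.1].
split; first by move=> x; apply: cvgM; [exact: Hf.1|exact: Hg.1].
have [_ [df Df]] := Hf; have [_ [dg Dg]] := Hg; split => [x v|v].
  exact: derivableM.
apply: Cn_ext (CnD (IH _ _ (CnS Hf) (Dg v)) (IH _ _ (CnS Hg) (Df v))) => x.
by rewrite -[LHS]deriveM.
Qed.

Lemma Cn_cst V n (r : R) : Cn n (fun _ : V => r).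
Proof.
elim: n r => [|n IH] r; first by split => // x; exact: cvg_cst.
split; first by move=> x; exact: cvg_cst.
split => [x v|v]; first exact: derivable_cst.
by apply: Cn_ext (IH 0) => x; rewrite derive_cst.
Qed.

Section affine.
Variables (V W : normedModType R) (phi L : V -> W).
Hypothesis phi_affine : forall h v x, phi (h *: v + x) = h *: L v + phi x.

Let quotE (f : W -> R) x v :
  (fun h => h^-1 *: ((f \o phi \o shift x) (h *: v) - (f \o phi) x)) =
  (fun h => h^-1 *: ((f \o shift (phi x)) (h *: L v) - f (phi x))).
Proof. by apply/funext => h /=; rewrite phi_affine. Qed.

(** The two difference quotients are literally the same function of [h], so the identity holds
    between limits whether or not they exist. This replaces the chain rule for projections,
    dilations and restrictions to lines, where only directional derivatives are at hand. *)
Lemma derive_affine (f : W -> R) x v : 'D_v (f \o phi) x = 'D_(L v) f (phi x).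
Proof. by rewrite /derive quotE. Qed.

Lemma derivable_affine (f : W -> R) x v :
  derivable f (phi x) (L v) -> derivable (f \o phi) x v.
Proof. by rewrite /derivable quotE. Qed.

Lemma Cn_affine n (f : W -> R) : continuous phi -> Cn n f -> Cn n (f \o phi).
Proof.
move=> cphi; elim: n f => [|n IH] f [cf Hf].
  by split => // x; apply: continuous_comp; [exact: cphi|exact: cf].
split; first by move=> x; apply: continuous_comp; [exact: cphi|exact: cf].
case: Hf => df Df; split => [x v|v]; first exact: derivable_affine.
by apply: Cn_ext (IH _ (Df (L v))) => x /=; rewrite derive_affine.
Qed.

End affine.
End Cn_theory.

(** * The flat function exp(-1/x) and its derivatives *)

Section flat_exponential.
Context {R : realType}.

(* The linear span of this family is stable under differentiation. *)
Definition flat_exp (k : nat) (x : R) : R :=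
  if 0 < x then x ^- k * expR (- x^-1) else 0.

Lemma flat_exp_ge0 k x : 0 <= flat_exp k x.
Proof.
rewrite /flat_exp; case: ifPn => // x0.
by rewrite mulr_ge0 ?expR_ge0 // invr_ge0 exprn_ge0 // ltW.
Qed.

(** For n = k+1 and x > 0, exp(-1/x) is the n-th power of exp(-1/(nx)), which is at most nx since
    exp t >= t. Hence exp(-1/x) <= n^n x^n, and dividing by x^k leaves one factor x. *)
Lemma flat_exp_le k x : flat_exp k x <= (k.+1%:R ^+ k.+1) * `|x|.
Proof.
rewrite /flat_exp; case: ifPn => x0; last by rewrite mulr_ge0 // exprn_ge0.
rewrite gtr0_norm //.
have -> : x^-1 = k.+1%:R * (k.+1%:R * x)^-1 :> R.
  by rewrite invfM mulVKf // pnatr_eq0.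
rewrite -mulrN expRM_natl expRN exprVn.
have /ltW : (k.+1%:R * x)^-1 < expR (k.+1%:R * x)^-1.
  by apply: lt_le_trans (expR_ge1Dx _); rewrite ltrDr.
rewrite -(@ler_pXn2r _ k.+1)// ?nnegrE ?invr_ge0 ?mulr_ge0 ?expR_ge0//;
    last exact: ltW.
rewrite exprVn exprMn => e.
have p0 : 0 < k.+1%:R ^+ k.+1 * x ^+ k.+1 by rewrite mulr_gt0 ?exprn_gt0 //.
rewrite -lef_pV2 ?posrE ?invr_gt0 ?exprn_gt0 ?expR_gt0 // invrK in e.
apply: le_trans (ler_wpM2l _ e) _; first by rewrite invr_ge0 exprn_ge0 // ltW.
by rewrite mulrCA (exprSr x) mulKf// expf_neq0 // gt_eqF.
Qed.

Lemma flat_exp_cvg0 k : flat_exp k x @[x --> 0] --> 0.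
Proof.
apply: (squeeze_cvgr (f := fun x => - ((k.+1%:R ^+ k.+1) * `|x|))
    (h := fun x => (k.+1%:R ^+ k.+1) * `|x|)).
- near=> x; rewrite flat_exp_le andbT.
  by rewrite (le_trans _ (flat_exp_ge0 k x)) // oppr_le0 mulr_ge0 // exprn_ge0.
- rewrite -[X in _ --> X]oppr0; apply: cvgN.
  rewrite -[X in _ --> X](mulr0 (k.+1%:R ^+ k.+1)); apply: cvgMr.
  by rewrite -[X in _ --> X](@normr0 _ R); exact: norm_continuous.
- rewrite -[X in _ --> X](mulr0 (k.+1%:R ^+ k.+1)); apply: cvgMr.
  by rewrite -[X in _ --> X](@normr0 _ R); exact: norm_continuous.
Unshelve. all: by end_near. Qed.

(** Away from 0 this is calculus on either branch. At 0 the difference quotient of [flat_exp k] is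
    exactly [flat_exp k.+1], which tends to 0 there. *)
Lemma is_derive_flat_exp k x : is_derive x (1 : R) (flat_exp k)
  (flat_exp k.+2 x + (- k%:R) * flat_exp k.+1 x).
Proof.
have [x0|x0|->] := ltgtP x 0.
- apply: (@near_eq_is_derive _ _ _ (cst 0)).
    near=> y; rewrite /flat_exp ifF //; apply: lt_gtF.
    by near: y; exact: lt_nbhsl.
  by rewrite /flat_exp !ifF ?mulr0 ?addr0 //;
      [exact: is_derive_cst|exact/lt_gtF|exact/lt_gtF].
- apply: (@near_eq_is_derive R R R (fun y : R => (y ^+ k)^-1 * expR (- y^-1) : R)).
    near=> y; rewrite /flat_exp ifT //.
    by near: y; exact: lt_nbhsr.
  rewrite /flat_exp x0.
  have xn0 : x != 0 by rewrite gt_eqF.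
  have d1 : is_derive x (1:R) (fun y : R => - y^-1) (x ^- 2).
    have d : is_derive x (1:R) (fun y : R => - y^-1) (- (- x ^- 2 *: (1:R))) :=
      is_deriveN (is_deriveV xn0 (is_derive_id x (1:R))).
    by apply: is_derive_eq d _; rewrite scaleNr opprK; exact: mulr1.
  have d2 : is_derive x (1:R) (fun y : R => expR (- y^-1)) (expR (- x^-1) * x ^- 2) :=
    @is_derive1_comp R expR (fun y : R => - y^-1) x _ _ (is_derive_expR (- x^-1)) d1.
  have d3 : is_derive x (1:R) (fun y : R => (y ^+ k)^-1) (- k%:R * x ^- k.+1).
    have d : is_derive x (1:R) (fun y : R => (y ^+ k)^-1)
        (- (x ^+ k) ^- 2 *: (k%:R *: x ^+ k.-1 *: (1:R))) :=
      @is_deriveV R (fun y => y ^+ k) x _ _ (expf_neq0 k xn0)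
        (DeriveDef (@exprn_derivable R k x (1:R)) (@exp_derive R k x (1:R))).
    apply: is_derive_eq d _; rewrite /GRing.scale /= mulr1.
    case: k => [|k]; first by rewrite mulr0n oppr0 !mul0r mulr0.
    by rewrite /= exprS (exprS x k.+1) exprS; field; rewrite expf_neq0.
  have d : is_derive x (1:R) (fun y : R => (y ^+ k)^-1 * expR (- y^-1))
    (x ^- k *: (expR (- x^-1) * x ^- 2) + expR (- x^-1) *: (- k%:R * x ^- k.+1)) :=
    is_deriveM d3 d2.
  apply: is_derive_eq d _; rewrite /GRing.scale /= !exprS; field.
  by rewrite xn0 expf_neq0.
- have fx0 j : flat_exp j 0 = 0 by rewrite /flat_exp ltxx.
  have : (fun h : R => h^-1 *: ((flat_exp k \o shift 0) (h *: (1:R)) - flat_exp k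
      0)) @ 0^' --> (0:R).
    rewrite (_ : (fun _ => _) = flat_exp k.+1).
      exact: cvg_within_filter (@flat_exp_cvg0 k.+1).
    apply/funext => h; rewrite fx0 subr0 /= addr0 /flat_exp /GRing.scale /= mulr1.
    case: ifP => h0; last by rewrite mulr0.
    by rewrite mulrA exprS invfM.
  move=> d0; rewrite !fx0 mulr0 addr0; split; first exact: (cvgP _ d0).
  exact: cvg_lim d0.
Unshelve. all: by end_near. Qed.

Lemma Cn_flat_exp n k : Cn n (flat_exp k).
Proof.
have df j x v : derivable (flat_exp j) x v.
  apply: diff_derivable; apply/derivable1_diffP.
  exact: (@ex_derive _ _ _ _ _ _ _ (is_derive_flat_exp j x)).
have Df j v x : 'D_v (flat_exp j) x =
    v * (flat_exp j.+2 x + (- j%:R) * flat_exp j.+1 x).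
  rewrite deriveE; last exact/derivable1_diffP.
  rewrite deriv1E // derive1E.
  by rewrite (@derive_val _ _ _ _ _ _ _ (is_derive_flat_exp j x)).
have cf j : continuous (flat_exp j).
  by move=> x; apply/differentiable_continuous/derivable1_diffP.
elim: n k => [|n IH] k; first by split.
split => //; split => // v.
have H : Cn n (fun x : R => v * (flat_exp k.+2 x + (- k%:R) * flat_exp k.+1 x)).
  apply: CnM; first exact: Cn_cst.
  by apply: CnD => //; apply: CnM => //; exact: Cn_cst.
by apply: Cn_ext H => x; rewrite Df.
Qed.

End flat_exponential.

(** * Test functions supported in boxes *)

Section box_bump.
Context {R : realType}.
Implicit Types (a b z : spacetime R).

(** The factor [m.+1] is positive for every [m], so all these bumps are nonzero on the same interval
    and only their steepness varies. *)
Definition bump1 (m : nat) (c d x : R) : R :=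
  flat_exp 0 (m.+1%:R * (x - c)) * flat_exp 0 (m.+1%:R * (d - x)).

Lemma flat_exp0_le1 x : flat_exp 0 x <= 1 :> R.
Proof.
rewrite /flat_exp; case: ifPn => // x0.
by rewrite expr0 invr1 mul1r -expR0 ler_expR oppr_le0 invr_ge0 ltW.
Qed.

Lemma flat_exp0_cvg1 (x : R) : 0 < x ->
    flat_exp 0 (m.+1%:R * x) @[m --> \oo] --> (1 : R).
Proof.
move=> x0; rewrite (_ : (fun _ => _) = (fun m => expR (- (harmonic m * x^-1))));
    last first.
  by apply/funext => m; rewrite /flat_exp mulr_gt0 // expr0 invr1 mul1r invfM.
rewrite -[X in _ --> X]expR0; apply: continuous_cvg; first exact: continuous_expR.
rewrite -[X in _ --> X]oppr0 -[in X in _ --> X](mul0r x^-1); apply: cvgN;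
    apply: cvgMl.
exact: cvg_harmonic.
Qed.

Lemma bump1_ge0 m c d x : 0 <= bump1 m c d x.
Proof. by rewrite mulr_ge0 ?flat_exp_ge0. Qed.

Lemma bump1_le1 m c d x : bump1 m c d x <= 1.
Proof. by rewrite mulr_ile1 ?flat_exp_ge0 ?flat_exp0_le1. Qed.

Lemma bump1_out m c d x : x \notin `]c, d[ -> bump1 m c d x = 0.
Proof.
rewrite in_itv /= negb_and -!leNgt => /orP[xc|dx]; rewrite /bump1 /flat_exp.
  by rewrite ifF ?mul0r// pmulr_rgt0 // subr_gt0 ltNge xc.
by rewrite mulrC ifF ?mul0r// pmulr_rgt0 // subr_gt0 ltNge dx.
Qed.

Lemma bump1_cvg c d x : bump1 m c d x @[m --> \oo] --> ((x \in `]c, d[)%:R : R).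
Proof.
have [xcd|/bump1_out xcd] := boolP (x \in `]c, d[).
  move: xcd; rewrite in_itv /= => /andP[cx xd]; rewrite -[X in _ --> X]mulr1.
  by apply: cvgM; apply: flat_exp0_cvg1; rewrite subr_gt0.
rewrite (_ : (fun _ => _) = (fun=> 0)); first exact: cvg_cst.
exact/funext.
Qed.

Lemma Cn_bump1 n m c d : Cn n (bump1 m c d).
Proof.
apply: CnM.
  apply: (@Cn_affine R _ _ (fun x : R => m.+1%:R * (x - c)) (fun x => m.+1%:R * x)).
  - by move=> h v x; rewrite /GRing.scale /=; ring.
  - by move=> x; apply: cvgMr; apply: cvgB; [exact: cvg_id|exact: cvg_cst].
  - exact: Cn_flat_exp.
apply: (@Cn_affine R _ _ (fun x : R => m.+1%:R * (d - x)) (fun x => - (m.+1%:R * x))).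
- by move=> h v x; rewrite /GRing.scale /=; ring.
- by move=> x; apply: cvgMr; apply: cvgB; [exact: cvg_cst|exact: cvg_id].
- exact: Cn_flat_exp.
Qed.

Definition obox a b : set (spacetime R) :=
  `]a.1.1.1, b.1.1.1[ `*` `]a.1.1.2, b.1.1.2[ `*` `]a.1.2, b.1.2[ `*` `]a.2, b.2[.

Definition cbox a b : set (spacetime R) :=
  `[a.1.1.1, b.1.1.1] `*` `[a.1.1.2, b.1.1.2] `*` `[a.1.2, b.1.2] `*` `[a.2, b.2].

Definition bump m a b z : R :=
  bump1 m a.1.1.1 b.1.1.1 z.1.1.1 * bump1 m a.1.1.2 b.1.1.2 z.1.1.2 *
  bump1 m a.1.2 b.1.2 z.1.2 * bump1 m a.2 b.2 z.2.

Lemma Cn_bump n m a b : Cn n (bump m a b).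
Proof.
have Cpi (pi : spacetime R -> R) c d : (forall h v x,
    pi (h *: v + x) = h *: pi v + pi x) ->
    continuous pi -> Cn n (bump1 m c d \o pi).
  by move=> piL pic; apply: (Cn_affine piL) => //; exact: Cn_bump1.
have c1 : continuous (fun z : spacetime R => z.1).
  by move=> z; exact: cvg_fst.
have c11 : continuous (fun z : spacetime R => z.1.1).
  by move=> z; apply: cvg_comp (c1 z) _; exact: cvg_fst.
apply: CnM; [apply: CnM; [apply: CnM|]|].
- apply: (Cpi (fun z => z.1.1.1)) => // z.
  by apply: cvg_comp (c11 z) _; exact: cvg_fst.
- apply: (Cpi (fun z => z.1.1.2)) => // z.
  by apply: cvg_comp (c11 z) _; exact: cvg_snd.
- apply: (Cpi (fun z => z.1.2)) => // z.
  by apply: cvg_comp (c1 z) _; exact: cvg_snd.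
- by apply: (Cpi (fun z => z.2)) => // z; exact: cvg_snd.
Qed.

Lemma compact_cbox a b : compact (cbox a b).
Proof. by do 3 (apply: compact_setX; last exact: segment_compact);
    exact: segment_compact. Qed.

Lemma obox_cbox a b : obox a b `<=` cbox a b.
Proof.
by move=> z [[[h1 h2] h3] h4]; split; [split; [split|]|] => /=;
    exact: subset_itv_oo_cc.
Qed.

Lemma bump_out m a b z : ~ obox a b z -> bump m a b z = 0.
Proof.
rewrite /bump.
have [h1|/bump1_out ->] := boolP (z.1.1.1 \in `]a.1.1.1, b.1.1.1[);
    last by rewrite !mul0r.
have [h2|/bump1_out ->] := boolP (z.1.1.2 \in `]a.1.1.2, b.1.1.2[);
    last by rewrite mulr0 !mul0r.
have [h3|/bump1_out ->] := boolP (z.1.2 \in `]a.1.2, b.1.2[);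
    last by rewrite mulr0 mul0r.
have [h4|/bump1_out ->] := boolP (z.2 \in `]a.2, b.2[); last by rewrite mulr0.
by case; split; [split; [split; [exact: h1|exact: h2]|exact: h3]|exact: h4].
Qed.

Lemma bump_01 m a b z : 0 <= bump m a b z <= 1.
Proof.
have P (x y : R) : 0 <= x <= 1 -> 0 <= y <= 1 -> 0 <= x * y <= 1.
  by move=> /andP[x0 x1] /andP[y0 y1]; rewrite mulr_ge0 ?mulr_ile1.
have b01 c d x : 0 <= bump1 m c d x <= 1 by rewrite bump1_ge0 bump1_le1.
by do 3 (apply: (P _ _) => //).
Qed.

Lemma bump_cvg a b z : bump m a b z @[m --> \oo] --> (\1_(obox a b) z : R).
Proof.
have [zo|zo] := boolP (z \in obox a b).
  rewrite indicE zo; move: zo => /set_mem[[[/= h1 h2] h3] h4].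
  rewrite (_ : true%:R = 1 * 1 * 1 * 1 :> R); last by rewrite !mulr1.
  apply: cvgM; [apply: cvgM; [apply: cvgM|]|].
  - by have := @bump1_cvg a.1.1.1 b.1.1.1 z.1.1.1; rewrite h1.
  - by have := @bump1_cvg a.1.1.2 b.1.1.2 z.1.1.2; rewrite h2.
  - by have := @bump1_cvg a.1.2 b.1.2 z.1.2; rewrite h3.
  - by have := @bump1_cvg a.2 b.2 z.2; rewrite h4.
rewrite indicE (negbTE zo); move: zo; rewrite notin_setE => zo.
rewrite (_ : (fun _ => _) = (fun=> 0)); first exact: cvg_cst.
by apply/funext => m; exact: bump_out.
Qed.

(** The support is a closure, so it is the closed box, not just the open one, that must lie in
    [U]. *)
Lemma bump_Ccinfty (U : set (spacetime R)) m a b :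
  cbox a b `<=` U -> Ccinfty U (bump m a b).
Proof.
move=> abU.
have clab : closed (cbox a b).
  by apply: compact_closed; [exact: norm_hausdorff|exact: compact_cbox].
have sab : supp (bump m a b) `<=` cbox a b.
  rewrite ((closure_id (cbox a b)).1 clab); apply: closure_subset => z /= /eqP h.
  by apply: obox_cbox; apply: contrapT => /bump_out.
split => //; first by move=> n; exact: Cn_bump.
- apply: subclosed_compact sab => //; [exact: closed_closure|exact: compact_cbox].
- exact: subset_trans abU.
Qed.

End box_bump.

(** * Boxes and the lemma of du Bois-Reymond *)

(** The exhaustions [g1], [g2] by generators give the cylinders over generators as countable unions
    of rectangles. The sets whose cylinder lies in the generated sigma-algebra then form a
    sigma-algebra, and a rectangle is the intersection of two cylinders. *)
Lemma measurable_prod_generated d1 d2 (T1 : measurableType d1)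
    (T2 : measurableType d2) (G1 : set (set T1)) (G2 : set (set T2))
    (g1 : nat -> set T1) (g2 : nat -> set T2) :
  @measurable _ T1 = <<s G1 >> -> @measurable _ T2 = <<s G2 >> ->
  (forall n, G1 (g1 n)) -> \bigcup_n g1 n = setT ->
  (forall n, G2 (g2 n)) -> \bigcup_n g2 n = setT ->
  @measurable _ (T1 * T2)%type = <<s [set A `*` B | A in G1 & B in G2] >>.
Proof.
move=> mG1 mG2 Gg1 g1T Gg2 g2T; rewrite measurable_prod_measurableType.
set H := [set A `*` B | A in G1 & B in G2].
apply/seteqP; split; apply: smallest_sub.
- exact: smallest_sigma_algebra.
- move=> _ [A mA [B mB <-]].
  have sH : sigma_algebra setT <<s H >> by exact: smallest_sigma_algebra.
  have HT C : G1 C -> <<s H >> (C `*` setT).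
    move=> GC; rewrite -g2T setX_bigcupr.
    apply: sigma_algebra_bigcup => n; apply: sub_sigma_algebra.
    by exists C => //; exists (g2 n).
  have TH C : G2 C -> <<s H >> (setT `*` C).
    move=> GC; rewrite -g1T setX_bigcupl.
    apply: sigma_algebra_bigcup => n; apply: sub_sigma_algebra.
    by exists (g1 n) => //; exists C.
  have HA : <<s H >> (A `*` setT).
    rewrite mG1 in mA; suff /(_ _ mA) : <<s G1 >> `<=` [set A | <<s H >> (A `*`
        setT)] by [].
    apply: smallest_sub => //; split => /=.
    + by rewrite set0X; exact: sigma_algebra0.
    + move=> C HC; rewrite setTD (_ : _ `*` _ = ~` (C `*` setT)).
        exact: sigma_algebraC.
      by apply/seteqP; split => -[x y] /=; [move=> [nx _] []|move=> h;
          split => // Cx; apply: h].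
    + by move=> F HF; rewrite setX_bigcupl; exact: sigma_algebra_bigcup.
  have HB : <<s H >> (setT `*` B).
    rewrite mG2 in mB; suff /(_ _ mB) : <<s G2 >> `<=` [set B | <<s H >> (setT
        `*` B)] by [].
    apply: smallest_sub => //; split => /=.
    + by rewrite setX0; exact: sigma_algebra0.
    + move=> C HC; rewrite setTD (_ : _ `*` _ = ~` (setT `*` C)).
        exact: sigma_algebraC.
      by apply/seteqP; split => -[x y] /=; [move=> [_ ny] []|move=> h;
          split => // Cy; apply: h].
    + by move=> F HF; rewrite setX_bigcupr; exact: sigma_algebra_bigcup.
  rewrite (_ : A `*` B = (A `*` setT) `&` (setT `*` B));
      last by rewrite -setXI setIT setTI.
  exact: (@measurableI _ (g_sigma_algebraType H)).
- exact: smallest_sigma_algebra.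
- move=> _ [A GA [B GB <-]]; apply: sub_sigma_algebra; exists A.
    by rewrite mG1; exact: sub_sigma_algebra.
  by exists B => //; rewrite mG2; exact: sub_sigma_algebra.
Qed.

Section boxes.
Context {R : realType}.
Implicit Types (a b z : spacetime R).

Let itvoo : set (set (measurableTypeR R)) :=
    [set A | exists x y, A = `]x, y[%classic].

Let itvooT : \bigcup_n `]- n%:R, n%:R[%classic = [set: R].
Proof.
apply/seteqP; split => // x _; exists (Num.truncn `|x|).+1 => //=.
rewrite in_itv /= -ltr_norml; exact: truncnS_gt.
Qed.

Lemma measurable_generated_obox :
  @measurable _ (borel31 R) = <<s [set obox a b | a in setT & b in setT] >>.
Proof.
have m1 : @measurable _ (measurableTypeR R) = <<s itvoo >>.
  exact: RGenOpens.measurableE.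
have i1 n : itvoo `]- n%:R, n%:R[%classic by exists (- n%:R), n%:R.
have m2 := measurable_prod_generated m1 m1 i1 itvooT i1 itvooT.
have i2 n : [set A `*` B | A in itvoo & B in itvoo] (`]- n%:R,
    n%:R[ `*` `]- n%:R, n%:R[).
  by exists `]- n%:R, n%:R[%classic => //; exists `]- n%:R, n%:R[%classic.
(* With one index shared by both factors, the rectangles still cover the product because both
   exhaustions increase. *)
have sqT (T U : Type) (F : nat -> set T) (G : nat -> set U) :
    {homo F : m n / (m <= n)%N >-> m `<=` n} ->
        {homo G : m n / (m <= n)%N >-> m `<=` n} ->
    \bigcup_n F n = setT -> \bigcup_n G n = setT -> \bigcup_n (F n `*` G n) = setT.
  move=> Fh Gh FT GT; apply/seteqP; split => // -[x y] _.
  have [m _ Fx] : (\bigcup_n F n) x by rewrite FT.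
  have [n _ Gy] : (\bigcup_n G n) y by rewrite GT.
  exists (maxn m n) => //; split; [apply: Fh Fx|apply: Gh Gy];
      rewrite ?leq_maxl ?leq_maxr//.
have h1 : {homo (fun n => `]- n%:R,
    n%:R[%classic : set R) : m n / (m <= n)%N >-> m `<=` n}.
  move=> m n mn x /=; rewrite !in_itv /= -!ltr_norml => h.
  by apply: lt_le_trans h _; rewrite ler_nat.
have h2 : {homo (fun n => `]- n%:R, n%:R[ `*` `]- n%:R,
    n%:R[ : set (R * R)) : m n / (m <= n)%N >-> m `<=` n}.
  by move=> m n mn [x y] [hx hy]; split;
      [exact: (h1 _ _ mn _ hx)|exact: (h1 _ _ mn _ hy)].
have h3 : {homo (fun n => `]- n%:R, n%:R[ `*` `]- n%:R, n%:R[ `*` `]- n%:R,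
    n%:R[ : set (R * R * R)) : m n / (m <= n)%N >-> m `<=` n}.
  by move=> m n mn [x y] [hx hy]; split;
      [exact: (h2 _ _ mn _ hx)|exact: (h1 _ _ mn _ hy)].
have T2 := sqT _ _ _ _ h1 h1 itvooT itvooT.
have m3 := measurable_prod_generated m2 m1 i2 T2 i1 itvooT.
have T3 := sqT _ _ _ _ h2 h1 T2 itvooT.
have m4 := @measurable_prod_generated _ _ _ _ _ _ _ _ m3 m1 _ T3 i1 itvooT.
rewrite m4 => [|n]; last first.
  exists (`]- n%:R, n%:R[ `*` `]- n%:R, n%:R[) => //.
  by exists `]- n%:R, n%:R[%classic.
congr (<<s _ >>); apply/seteqP; split.
  move=> _ [_ [_ [_ [x1 [y1 ->]] [_ [x2 [y2 ->]] <-]] [_ [x3 [y3 ->]] <-]] [_ [x4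
      [y4 ->]] <-]].
  by exists (x1, x2, x3, x4) => //; exists (y1, y2, y3, y4).
move=> _ [[[[x1 x2] x3] x4] _ [[[[y1 y2] y3] y4] _ <-]].
exists (`]x1, y1[ `*` `]x2, y2[ `*` `]x3, y3[); last first.
  by exists `]x4, y4[%classic => //; exists x4, y4.
exists (`]x1, y1[ `*` `]x2, y2[); last first.
  by exists `]x3, y3[%classic => //; exists x3, y3.
exists `]x1, y1[%classic; first by exists x1, y1.
by exists `]x2, y2[%classic => //; exists x2, y2.
Qed.

Lemma measurable_obox a b : measurable (obox a b : set (borel31 R)).
Proof. by do 3 (apply: measurableX; last exact: measurable_itv);
    exact: measurable_itv. Qed.

Lemma measurable_cbox a b : measurable (cbox a b : set (borel31 R)).
Proof. by do 3 (apply: measurableX; last exact: measurable_itv);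
    exact: measurable_itv. Qed.

Definition rat_point (q : rat * rat * rat * rat) : spacetime R :=
  (ratr q.1.1.1, ratr q.1.1.2, ratr q.1.2, ratr q.2).

Definition rat_box (q : (rat * rat * rat * rat) * (rat * rat * rat * rat)) :=
  obox (rat_point q.1) (rat_point q.2).

Definition crat_box (q : (rat * rat * rat * rat) * (rat * rat * rat * rat)) :=
  cbox (rat_point q.1) (rat_point q.2).

(** The product carries the sup norm, so its balls are boxes: rational endpoints within [e] of each
    coordinate, on either side, do. *)
Lemma open_rat_box (U : set (spacetime R)) z : open U -> U z ->
  exists q, rat_box q z /\ crat_box q `<=` U.
Proof.
move=> oU Uz; have /nbhs_ballP[e /= e0 eU] : nbhs z U by exact: open_nbhs_nbhs.
have rl (x : R) : exists q : rat, x - e < ratr q < x.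
  have /rat_in_itvoo[q] : x - e < x by rewrite gtrBl.
  by rewrite in_itv /= => ?; exists q.
have rr (x : R) : exists q : rat, x < ratr q < x + e.
  have /rat_in_itvoo[q] : x < x + e by rewrite ltrDl.
  by rewrite in_itv /= => ?; exists q.
have [c1 /andP[c1l c1r]] := rl z.1.1.1; have [c2 /andP[c2l c2r]] := rl z.1.1.2.
have [c3 /andP[c3l c3r]] := rl z.1.2; have [c4 /andP[c4l c4r]] := rl z.2.
have [d1 /andP[d1l d1r]] := rr z.1.1.1; have [d2 /andP[d2l d2r]] := rr z.1.1.2.
have [d3 /andP[d3l d3r]] := rr z.1.2; have [d4 /andP[d4l d4r]] := rr z.2.
exists ((c1, c2, c3, c4), (d1, d2, d3, d4)); split.
  by split; [split; [split|]|]; rewrite /= in_itv /=; apply/andP.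
move=> w [[[/= w1 w2] w3] w4]; apply: eU.
have bE (x y p q : R) : x - e < p -> q < x + e -> y \in `[p, q] -> ball x e y.
  rewrite in_itv /= => h1 h2 /andP[h3 h4]; rewrite -ball_normE /ball_ /=.
  by rewrite ltr_norml; apply/andP; split; lra.
split; [split; [split|]|];
    [exact: bE c1l d1r w1|exact: bE c2l d2r w2|exact: bE c3l d3r w3|exact: bE c4l
    d4r w4].
Qed.

(** The sigma-algebra is the product one, so openness has to be reduced to it: an open set is a
    countable union of rational boxes. *)
Lemma open_measurable31 (U : set (spacetime R)) : open U ->
    measurable (U : set (borel31 R)).
Proof.
move=> oU; rewrite (_ : U = \bigcup_q (if `[< crat_box q `<=` U >] then rat_box q
    else set0)).
  apply: countable_bigcupT_measurable; first exact: countableP.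
  by move=> q; case: ifP => // _; exact: measurable_obox.
apply/seteqP; split => [z /(open_rat_box oU)[q [qz qU]]|z [q _]].
  by exists q => //; case: asboolP.
by case: asboolP => // qU /obox_cbox /qU.
Qed.

Lemma compact_measurable31 (K : set (spacetime R)) : compact K ->
    measurable (K : set (borel31 R)).
Proof.
move=> cK; have clK : closed K by apply: compact_closed; [exact: norm_hausdorff|].
by rewrite -(setCK K); apply: measurableC; apply: open_measurable31;
    exact: closed_openC.
Qed.

Lemma continuous_measurable31 (f : spacetime R -> R) : continuous f ->
  measurable_fun setT (f : borel31 R -> R).
Proof.
move=> cf; apply: (measurability _ (RGenOpens.measurableE R)).
move=> _ [_ [x [y ->]] <-]; rewrite setTI; apply: open_measurable31.
by apply: open_comp => // z _; exact: cf.
Qed.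

(** Reduces to spacetime: the cylinder over [K] is closed there, and [K] is its section at time
    0. *)
Lemma closed_measurable3 (K : set (space3 R)) : closed K ->
    measurable (K : set (borel3 R)).
Proof.
move=> cK.
have oK : open (~` ((fun z : spacetime R => z.1) @^-1` K)).
  apply: closed_openC; apply: (@closed_comp _ _ (fun z : spacetime R => z.1)) =>
      // z _.
  exact: cvg_fst.
have /measurableC := open_measurable31 oK; rewrite setCK => mK.
have := measurable_ysection (0 : measurableTypeR R) mK.
congr measurable; apply/seteqP; split => x /=; by rewrite /ysection /= inE.
Qed.

(** Supplies the pi-system of the Dynkin argument; corners are unordered, so empty intersections are
    boxes as well. *)
Lemma obox_setI a b c d : obox a b `&` obox c d =
  obox (Num.max a.1.1.1 c.1.1.1, Num.max a.1.1.2 c.1.1.2,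
        Num.max a.1.2 c.1.2, Num.max a.2 c.2)
       (Num.min b.1.1.1 d.1.1.1, Num.min b.1.1.2 d.1.1.2,
        Num.min b.1.2 d.1.2, Num.min b.2 d.2).
Proof.
have E (p q r s x : R) : x \in `]Num.max p r, Num.min q s[ = (x \in `]p,
    q[) && (x \in `]r, s[).
  by rewrite !in_itv /= gt_max lt_min andbACA.
apply/seteqP; split => z; rewrite /obox /= !E.
  move=> [[[[h1 h2] h3] h4] [[[k1 k2] k3] k4]].
  by split; [split; [split|]|]; apply/andP; split.
move=> [[[/andP[h1 k1] /andP[h2 k2]] /andP[h3 k3]] /andP[h4 k4]].
by split; (split; [split; [split|]|]).
Qed.

End boxes.

Section du_bois_reymond.
Context {R : realType}.
Variables (U : set (spacetime R)) (h : spacetime R -> R).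
Local Notation mu := (leb31 R).
Hypothesis h_int : forall a b, cbox a b `<=` U ->
  mu.-integrable (cbox a b : set (borel31 R)) (EFin \o h).
Hypothesis h_test : forall psi, Ccinfty U psi -> \int[mu]_(z in U) (h z * psi z) = 0.

(** The products of [h] with the bumps integrate to 0 and are dominated by |h|, integrable on the
    closed box; dominated convergence passes to the indicator. *)
Let integral_obox a b : cbox a b `<=` U -> (\int[mu]_(z in obox a b) (h z)%:E = 0)%E.
Proof.
move=> abU; have hi := h_int abU.
have mC := measurable_cbox a b; have mO := measurable_obox a b.
have mh : measurable_fun (cbox a b : set (borel31 R)) h.
  by apply/measurable_EFinP; exact: measurable_int hi.
have mb m : measurable_fun (cbox a b : set (borel31 R)) (bump m a b : borel31 R -> R).
  apply: measurable_funTS; apply: continuous_measurable31.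
  by have [] := Cn_bump 0 m a b.
have mhb m : measurable_fun (cbox a b : set (borel31 R)) (fun z => (h z * bump m
    a b z)%:E).
  by apply/measurable_EFinP; apply: measurable_funM.
have bh m z : `|h z * bump m a b z| <= `|h z|.
  have /andP[b0 b1] := bump_01 m a b z.
  by rewrite normrM (ger0_norm b0) ler_piMr.
have fi m : mu.-integrable (cbox a b : set (borel31 R)) (fun z => (h z * bump m a
    b z)%:E).
  apply: le_integrable hi => // z _.
  by rewrite /= lee_fin.
have f0 m : (\int[mu]_(z in cbox a b) (h z * bump m a b z)%:E = 0)%E.
  have := h_test (bump_Ccinfty m abU).
  rewrite /Rintegral integral_mkcond [in X in _ -> X]integral_mkcond.
  rewrite (_ : _ \_ U = (fun z => (h z * bump m a b z)%:E) \_ (cbox a b)); last first.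
    apply/funext => z; rewrite !patchE.
    have [zab|zab] := boolP (z \in cbox a b); first by rewrite mem_set//;
        exact/abU/set_mem.
    rewrite bump_out ?mulr0 ?if_same// => /obox_cbox.
    by move: zab; rewrite notin_setE.
  rewrite -integral_mkcond => f0.
  (* [h_test] speaks of the real-valued integral, which is 0 also when the extended one is infinite;
     integrability rules this out. *)
  by rewrite -[LHS]fineK ?f0//; exact: integrable_fin_num.
have mhO : measurable_fun (cbox a b : set (borel31 R)) (fun z => (h z * \1_(obox
    a b) z)%:E).
  by apply/measurable_EFinP; apply: measurable_funM => //; exact: measurable_indic.
have dom1 : {ae mu, forall z, cbox a b z -> (h z * bump m a b z)%:E @[m --> \oo] -->
    (h z * \1_(obox a b) z)%:E}.
  apply: aeW => z _; apply: cvg_EFin; first exact: nearW.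
  by apply: cvgMr; exact: bump_cvg.
have dom2 : {ae mu, forall z m,
    cbox a b z -> (`|(h z * bump m a b z)%:E| <= `|(h z)%:E|)%E}.
  by apply: aeW => z m _; rewrite /= lee_fin.
have [_ _] := dominated_convergence mC mhb mhO dom1 (integrable_abse hi) dom2.
rewrite (_ : [sequence _]_n = (fun=> 0%E)); last by apply/funext.
move=> /(cvg_unique _ (cvg_cst _)) => /(_ (@ereal_hausdorff _)) C.
rewrite integral_mkcond C [RHS]integral_mkcond; apply: eq_integral => z _.
rewrite !patchE indicE; have [zo|zo] := boolP (z \in obox a b).
  by rewrite mulr1 mem_set//; exact/obox_cbox/set_mem.
by rewrite mulr0 if_same.
Qed.

(** Extended by 0 outside the box, [h] is integrable on the whole space. The sets over which it
    integrates to 0 are then closed under complement and countable disjoint union, and contain all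
    boxes since a box meets the given one in a box. *)
Let ae_obox a b : cbox a b `<=` U -> {ae mu, forall z, obox a b z -> h z = 0}.
Proof.
move=> abU; pose H := (EFin \o h) \_ (obox a b).
have mO := measurable_obox a b.
have Hi : mu.-integrable setT H.
  apply/(integrable_mkcond _ mO).1; apply: integrableS (h_int abU) => //.
    exact: measurable_cbox.
  exact: obox_cbox.
have HE S : (\int[mu]_(z in S) H z = \int[mu]_(z in S `&` obox a b) (h z)%:E)%E.
  by rewrite integral_mkcondr.
have H0 S : measurable S -> (\int[mu]_(z in S) H z = 0)%E.
  rewrite measurable_generated_obox; move: S.
  apply: (dynkin_induction (P :=
      fun S => (\int[mu]_(z in S) H z = 0)%E) measurable_generated_obox).
  - move=> _ _ [c _ [d _ <-]] [c' _ [d' _ <-]]; rewrite obox_setI.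
    by eexists => //; eexists => //.
  - by rewrite HE setTI; exact: integral_obox.
  - move=> _ [c _ [d _ <-]] /=; rewrite HE setIC obox_setI; apply: integral_obox.
    apply: subset_trans abU => z [[[/= h1 h2] h3] h4].
    have E (p q r s x : R) : x \in `[Num.max p r, Num.min q s] -> x \in `[p, q].
      by rewrite !in_itv /= ge_max le_min => /andP[/andP[-> _] /andP[-> _]].
    by split; [split; [split|]|]; [exact: E h1|exact: E h2|exact: E h3|exact: E h4].
  - move=> S mS S0.
    have : (\int[mu]_(z in S `|` ~` S) H z = 0)%E.
      by rewrite setUv HE setTI; exact: integral_obox.
    rewrite integral_setU//; last 3 first.
    + exact: measurableC.
    + by rewrite setUv; exact: measurable_int Hi.
    + by apply/disj_set2P; rewrite setICr.
    by rewrite S0 add0e.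
  - move=> F mF tF F0; rewrite integral_bigcup//.
      by apply: eseries0 => n _ _; exact: F0.
    by apply: integrableS Hi => //; exact: bigcup_measurable.
have /= := @integral_ae_eq _ _ _ mu setT measurableT (cst 0%E) H Hi
    (measurable_cst _).
move=> /(_ _)/wrap[].
  by move=> E _ mE; rewrite H0// integral0.
apply: (@filterS _ _ (ae_filter_ringOfSetsType mu)) => z /(_ I).
by rewrite /H patchE => Hz zO; move: Hz; rewrite mem_set// => -[].
Qed.

(** Countably many rational boxes with closed hull in [U] cover [U], so the exceptional null sets
    add up to a null set. *)
Lemma du_bois_reymond : open U -> {ae mu, forall z, U z -> h z = 0}.
Proof.
move=> oU.
have H n : {ae mu, forall z, (if unpickle n is Some q then
    crat_box q `<=` U -> rat_box q z -> h z = 0 else True)}.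
  case: (unpickle n) => [q|]; last exact: aeW.
  have [qU|nqU] := pselect (crat_box q `<=` U); last exact: aeW.
  by apply: (@filterS _ _ (ae_filter_ringOfSetsType mu)) (ae_obox qU) => z Hz _;
      exact: Hz.
have := ae_foralln H; apply: (@filterS _ _ (ae_filter_ringOfSetsType mu)) => z Hz Uz.
have [q [qz qU]] := open_rat_box oU Uz.
by have := Hz (pickle q); rewrite pickleK; exact.
Qed.

End du_bois_reymond.

(** * Weak derivatives under parabolic scaling *)

Section geometry.
Context {R : realType}.

Lemma enorm_coord (y : space3 R) :
  enorm (Defs.coord y) = Num.sqrt (y.1.1 ^+ 2 + y.1.2 ^+ 2 + y.2 ^+ 2).
Proof. by rewrite /enorm !big_ord_recl big_ord0 /= addr0 addrA. Qed.

Lemma open_eball (r : R) : open (eball r).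
Proof.
have E : eball r = (fun y : space3 R => Num.sqrt (y.1.1 ^+ 2 + y.1.2 ^+ 2 + y.2
    ^+ 2)) @^-1` `]-oo, r[.
  by apply/seteqP; split => y; rewrite /eball /= enorm_coord in_itv.
rewrite E; apply: open_comp; last exact: interval_open.
move=> y _; apply: continuous_comp; last exact: sqrt_continuous.
have c1 : (fun y : space3 R => y.1) @ y --> y.1 by exact: cvg_fst.
by apply: cvgD; [apply: cvgD|]; apply: cvgM;
  (exact: cvg_snd || (apply: cvg_comp c1 _; (exact: cvg_fst || exact: cvg_snd))).
Qed.

Lemma open_Q1 : open (@Q1 R).
Proof.
rewrite (_ : @Q1 R = (fst @^-1` eball 1) `&` (snd @^-1` `]-1, 0[)) //.
apply: openI; apply: open_comp => [z _|]; [exact: cvg_fst|exact: open_eball| |].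
  exact: cvg_snd.
exact: interval_open.
Qed.

Lemma enorm_scale (c : R) (y : space3 R) : 0 <= c ->
  enorm (Defs.coord (c *: y)) = c * enorm (Defs.coord y).
Proof.
move=> c0; rewrite !enorm_coord /= /GRing.scale /= !exprMn -!mulrDr.
by rewrite sqrtrM ?sqr_ge0 // sqrtr_sqr ger0_norm.
Qed.

Lemma parabolic_Q1 (c : R) z : 0 < c -> c <= 1 -> Q1 z -> Q1 (parabolic c z).
Proof.
move=> c0 c1 [z1 z2]; split.
  rewrite /= /eball /= enorm_scale ?ltW//; apply: le_lt_trans z1.
  by rewrite ler_piMl // sqrtr_ge0.
move: z2; rewrite /= !in_itv /= => /andP[z2l z2r].
have c20 : 0 < c ^+ 2 by rewrite exprn_gt0.
have c21 : c ^+ 2 <= 1 by rewrite exprn_ile1 // ltW.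
by rewrite pmulr_rlt0 // z2r andbT; nra.
Qed.

Lemma parabolicK (c : R) : c != 0 -> cancel (parabolic c) (parabolic c^-1).
Proof.
move=> c0 [y s]; rewrite /parabolic /= scalerA mulVf // scale1r.
by rewrite exprVn mulKf // expf_neq0.
Qed.

Lemma parabolicVK (c : R) : c != 0 -> cancel (parabolic c^-1) (parabolic c).
Proof. by move=> c0 z; rewrite -[X in parabolic X](invrK c) parabolicK //
    invr_neq0. Qed.

Lemma parabolic_linear (c h : R) v z :
  parabolic c (h *: v + z) = h *: parabolic c v + parabolic c z.
Proof.
by rewrite /parabolic; congr pair;
    rewrite /= ?scalerDr ?scalerA 1?mulrC// /GRing.scale /=; ring.
Qed.

Lemma continuous_parabolic (c : R) : continuous (@parabolic R c).
Proof.
move=> z; have H1 : (fun z : spacetime R => c *: z.1) @ z --> c *: z.1.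
  have c1 : (fun z : spacetime R => z.1) @ z --> z.1 by exact: cvg_fst.
  exact: (cvg_comp _ _ c1 (@scaler_continuous _ _ c z.1)).
have H2 : (fun z : spacetime R => c ^+ 2 * z.2) @ z --> c ^+ 2 * z.2.
  by apply: cvgMr; exact: cvg_snd.
exact: (cvg_pair H1 H2).
Qed.

End geometry.

Section derive_scale.
Context {R : realType} {V : normedModType R}.

(** Only the derivative along [v] is assumed, so [f] is restricted to the line through [x] along
    [v]; in one variable derivability is differentiability, which is linear in the direction. *)
Lemma derive_scalev (f : V -> R) (x v : V) (c : R) : derivable f x v ->
  'D_(c *: v) f x = c * 'D_v f x.
Proof.
move=> fxv; pose phi (h : R) : V := h *: v + x.
have phiE (h w y : R) : phi (h *: w + y) = h *: (w *: v) + phi y.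
  by rewrite /phi scalerDl scalerA addrA.
have phi0 : phi 0 = x by rewrite /phi scale0r add0r.
have D (w : R) : 'D_w (f \o phi) 0 = 'D_(w *: v) f x.
  by rewrite (derive_affine phiE) phi0.
have d1 : derivable (f \o phi) 0 1.
  by apply: (derivable_affine phiE); rewrite phi0 scale1r.
rewrite -[v in RHS](scale1r v) -!D deriveE; last exact/derivable1_diffP.
rewrite deriv1E//.
by rewrite derive1E.
Qed.

Lemma Cn_derivable n (f : V -> R) x v : Cn n.+1 f -> derivable f x v.
Proof. by case=> _ [+ _]; exact. Qed.

Lemma Cn_derive n (f : V -> R) v : Cn n.+1 f -> Cn n (fun x => 'D_v f x).
Proof. by case=> _ [_ +]; exact. Qed.

Lemma Cn_continuous n (f : V -> R) : Cn n f -> continuous f.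
Proof. by case: n => [|n] []. Qed.

(** Off its closed support [f] vanishes in a whole neighbourhood, and so does its derivative. *)
Lemma supp_deriv (f : V -> R) v : supp (fun x => 'D_v f x) `<=` supp f.
Proof.
rewrite /supp [X in _ `<=` X](closure_id _).1; last exact: closed_closure.
apply: closure_subset => x /= Df; apply: contrapT => nx.
move: Df; apply/negP; rewrite negbK; apply/eqP.
rewrite (@near_eq_derive _ _ _ _ (cst 0)) ?derive_cst//.
have : nbhs x (~` closure [set x | f x != 0]).
  by apply: open_nbhs_nbhs; split => //; exact/closed_openC/closed_closure.
apply: filterS => y /= ny; apply/eqP/negPn/negP => fy; apply: ny.
exact: subset_closure.
Qed.

Lemma supp_out (f : V -> R) x : ~ supp f x -> f x = 0.
Proof.
by move=> nx; apply/eqP/negPn/negP => fx; apply: nx; exact: subset_closure.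
Qed.

Lemma compact_supp_bounded (f : V -> R) : continuous f -> compact (supp f) ->
  exists2 M : R, 0 <= M & forall x, `|f x| <= M.
Proof.
move=> cf csf; have [s0|s0] := pselect (supp f !=set0); last first.
  exists 0 => // x; rewrite supp_out ?normr0// => sx; apply: s0; by exists x.
have [|c _ fc] := @compact_EVT_max V R (fun x => `|f x|) (supp f) s0 csf.
  apply: continuous_subspaceT => x; apply: continuous_comp; first exact: cf.
  exact: norm_continuous.
exists `|f c| => // x; have [sx|sx] := pselect (supp f x).
  by apply: fc; rewrite inE.
by rewrite supp_out // normr0.
Qed.

End derive_scale.

Section weak_derivative.
Context {R : realType}.
Local Notation mu := (leb31 R).

Lemma measurable_fun_normr d (T : measurableType d) (D : set T) (f : T -> R) :
  measurable_fun D f -> measurable_fun D (fun x => `|f x|).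
Proof. by move=> mf; apply: measurableT_comp. Qed.

(** The integral lives on the compact support of [psi], where [psi] is bounded and [f]
    integrable. *)
Lemma locally_integrable_test (U : set (spacetime R)) f psi : open U ->
  locally_integrable_on U f -> continuous psi ->
  compact (supp psi) -> supp psi `<=` U ->
  mu.-integrable (U : set (borel31 R)) (fun z => (f z * psi z)%:E).
Proof.
move=> oU [mf fi] cpsi csupp sU.
have mU := open_measurable31 oU; have mS := compact_measurable31 csupp.
have mp : measurable_fun U (fun z => (f z * psi z)%:E).
  apply/measurable_EFinP/measurable_funM => //.
  by apply: measurable_funTS; exact: continuous_measurable31.
have [M M0 psiM] := compact_supp_bounded cpsi csupp.
apply/integrableP; split => //.
rewrite (_ : (\int[mu]_(x in U) _ = \int[mu]_(x in supp psi) `|(f x * psi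
    x)%:E|)%E); last first.
  rewrite integral_mkcond [RHS]integral_mkcond; apply: eq_integral => z _.
  rewrite !patchE; have [zs|zs] := boolP (z \in supp psi).
    by rewrite mem_set//; exact/sU/set_mem.
  by rewrite supp_out ?mulr0 ?abse0 ?if_same//; move: zs; rewrite notin_setE.
apply: (@le_lt_trans _ _ (\int[mu]_(z in supp psi) (M%:E * `|f z|%:E))%E).
  apply: ge0_le_integral => //.
  - apply/measurable_EFinP/measurable_fun_normr/measurable_EFinP.
    exact: (measurable_funS mU sU mp).
  - apply/measurable_EFinP/measurable_funM => //; apply: measurable_fun_normr.
    exact: (measurable_funS mU sU mf).
  - by move=> z _; rewrite lee_fin normrM mulrC ler_wpM2r.
rewrite ge0_integralZl//; last first.
- apply/measurable_EFinP/measurable_fun_normr.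
  exact: (measurable_funS mU sU mf).
by apply: lte_mul_pinfty => //; exact: fi.
Qed.

(** Both derivatives have the same pairing with every test function, so their difference satisfies
    the hypotheses of [du_bois_reymond]. *)
Lemma is_weak_dx_unique (U : set (spacetime R)) j f g1 g2 : open U ->
  is_weak_dx U j f g1 -> is_weak_dx U j f g2 -> {ae mu, forall z, U z -> g1 z = g2 z}.
Proof.
move=> oU [_ lg1 D1] [_ lg2 D2].
have mU := open_measurable31 oU.
have gi g : locally_integrable_on U g -> forall a b, cbox a b `<=` U ->
    mu.-integrable (cbox a b : set (borel31 R)) (EFin \o g).
  move=> [mg hg] a b abU; apply/integrableP; split.
    by apply/measurable_EFinP; exact: (measurable_funS mU abU mg).
  have := hg _ (@compact_cbox R a b) abU.
  exact.
have := @du_bois_reymond R U (fun z => g1 z - g2 z) _ _ oU.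
move=> /(_ _)/wrap[].
  move=> a b abU; apply: eq_integrable (integrableB (measurable_cbox a b) (gi _
      lg1 _ _ abU) (gi _ lg2 _ _ abU)) => //.
  exact: measurable_cbox.
move=> /(_ _)/wrap[].
  move=> psi tpsi; have [spsi csupp sU] := tpsi.
  have cpsi := Cn_continuous (spsi 0).
  under eq_Rintegral do rewrite mulrBl.
  rewrite RintegralB//; last 2 first.
    exact: locally_integrable_test.
    exact: locally_integrable_test.
  by apply/eqP; rewrite subr_eq0 -eqr_opp -D1// -D2.
by apply: (@filterS _ _ (ae_filter_ringOfSetsType mu)) => z Hz /Hz /eqP;
    rewrite subr_eq0 => /eqP.
Qed.

Section rescaling.
Variables (c : R) (c0 : 0 < c) (c1 : c <= 1).
Local Notation T := (parabolic c : borel31 R -> borel31 R).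

Let cn0 : c != 0. Proof. by rewrite gt_eqF. Qed.

Let mQ1 : measurable (@Q1 R : set (borel31 R)).
Proof. exact: open_measurable31 open_Q1. Qed.

Lemma measurable_fun_parabolic (D : set (borel31 R)) (E : set (borel31 R))
    (f : borel31 R -> R) : measurable E -> D `<=` T @^-1` E -> measurable_fun E f ->
  measurable_fun D (fun z => f (T z)).
Proof.
move=> mE DE mf; apply: (measurable_comp mE _ mf) => [_ [z Dz <-]|]; first exact: DE.
apply: measurable_funTS; exact: measurable_parabolic.
Qed.

Let measurable_fun_Q1_parabolic (f : borel31 R -> R) :
  measurable_fun (@Q1 R) f -> measurable_fun (@Q1 R) (fun z => f (T z)).
Proof. by apply: measurable_fun_parabolic => // z; exact: parabolic_Q1. Qed.

Lemma locally_integrable_parabolic (f : scalar_field R) (k : R) :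
  locally_integrable_on (@Q1 R) f ->
  locally_integrable_on (@Q1 R) (fun z => k * f (parabolic c z)).
Proof.
move=> [mf fi]; split.
  apply: measurable_funM; first exact: measurable_cst.
  exact: measurable_fun_Q1_parabolic.
move=> K cK KQ; have mK := compact_measurable31 cK.
pose TK := parabolic c @` K.
have cTK : compact TK.
  by apply: continuous_compact => //; apply: continuous_subspaceT;
      exact: continuous_parabolic.
have mTK := compact_measurable31 cTK.
have TKQ : TK `<=` @Q1 R by move=> _ [z Kz <-]; apply: parabolic_Q1 => //; exact: KQ.
have KE : T @^-1` TK = K.
  apply/seteqP; split => [z [w Kw wz]|z Kz]; last by exists z.
  by rewrite -(can_inj (parabolicK cn0) wz).
have mfT : measurable_fun K (fun z => `|f (T z)|).
  apply: measurable_fun_normr; apply: (measurable_funS mQ1 KQ).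
  exact: measurable_fun_Q1_parabolic.
have mfTK : measurable_fun TK (fun z => `|f z|).
  by apply: measurable_fun_normr; exact: measurable_funS TKQ mf.
have := fi TK cTK TKQ; rewrite (ge0_integral_parabolic c0)//;
    last exact/measurable_EFinP.
rewrite KE => fioo.
rewrite (_ : (\int[_]_(_ in _) _ = `|k|%:E * \int[mu]_(z in K) `|f (T z)|%:E)%E);
    last first.
  rewrite -ge0_integralZl//; last exact/measurable_EFinP.
  by apply: eq_integral => z _; rewrite -EFinM normrM.
have c5 : (0 < (c ^+ 5)%:E)%E by rewrite lte_fin exprn_gt0.
apply: lte_mul_pinfty => //.
(* An infinite integral would stay infinite after multiplication by c^5 > 0. *)
move: fioo; case: (\int[_]_(_ in _) _)%E => [r _||] //; first exact: ltry.
by rewrite gt0_muley.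
Qed.

(** The preimage of [Q1] under [T] contains [Q1] and may be larger; [F] vanishing there outside [Q1]
    removes the excess. *)
Let Rintegral_Q1_parabolic (F : borel31 R -> R) : measurable_fun (@Q1 R) F ->
  (forall z, ~ Q1 z -> F (T z) = 0) ->
  \int[mu]_(z in @Q1 R) F z = c ^+ 5 * \int[mu]_(z in @Q1 R) F (T z).
Proof.
move=> mF F0; rewrite (Rintegral_parabolic c0)//; congr (_ * _).
rewrite Rintegral_mkcond [RHS]Rintegral_mkcond; apply: eq_Rintegral => z _.
rewrite !patchE; have [zQ|zQ] := boolP (z \in @Q1 R).
  by rewrite mem_set //; apply: parabolic_Q1 => //; exact: set_mem.
by rewrite F0 ?if_same//; move: zQ; rewrite notin_setE.
Qed.

(** One factor [c] is the amplitude of [f'], the other comes from differentiating the dilation. Test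
    functions travel the other way: [psi] composed with the inverse of [T] has support in [T] of
    [Q1], inside [Q1], so it may be tested against [f]. *)
Lemma is_weak_dx_parabolic j (f g f' : scalar_field R) :
  is_weak_dx (@Q1 R) j f g ->
  (forall z, Q1 z -> f' z = c * f (parabolic c z)) ->
  is_weak_dx (@Q1 R) j f' (fun z => c ^+ 2 * g (parabolic c z)).
Proof.
move=> [lf lg fg] f'E.
have [mcf cfi] := locally_integrable_parabolic c lf.
split; [split| |].
- by apply: eq_measurable_fun mcf => z /set_mem zQ; rewrite f'E.
- move=> K cK KQ; apply: le_lt_trans (cfi K cK KQ).
  rewrite le_eqVlt; apply/orP; left; apply/eqP.
  by apply: eq_integral => z /set_mem/KQ zQ; rewrite f'E.
- exact: locally_integrable_parabolic.
move=> psi [spsi csupp sQ].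
(* The factor [c ^+ 2] makes the chain rule produce exactly the constants of the
   statement, so that none has to be pulled out of an integral. *)
pose chi (z : spacetime R) := c ^+ 2 * psi (parabolic c^-1 z).
have SL h v z := @parabolic_linear R c^-1 h v z.
have chi_smooth : smooth chi.
  move=> n; apply: CnM; first exact: Cn_cst.
  by apply: (Cn_affine SL) => //; exact: continuous_parabolic.
have supp_chi : supp chi `<=` parabolic c @` supp psi.
  have cl : closed (parabolic c @` supp psi).
    apply: compact_closed; first exact: norm_hausdorff.
    by apply: continuous_compact => //; apply: continuous_subspaceT;
        exact: continuous_parabolic.
  rewrite ((closure_id _).1 cl); apply: closure_subset => z /=.
  rewrite mulf_eq0 negb_or => /andP[_ pz]; exists (parabolic c^-1 z);
      last exact: parabolicVK.
  exact: subset_closure.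
have chi_test : Ccinfty (@Q1 R) chi.
  split => //.
  - apply: subclosed_compact supp_chi; first exact: closed_closure.
    by apply: continuous_compact => //; apply: continuous_subspaceT;
        exact: continuous_parabolic.
  - by move=> z /supp_chi[w /sQ Qw <-]; exact: parabolic_Q1.
have chiT z : chi (T z) = c ^+ 2 * psi z by rewrite /chi parabolicK.
have dxchiT z : dx j chi (T z) = c * dx j psi z.
  rewrite /dx /chi.
  have dpsi v w : derivable psi w v by exact: (@Cn_derivable _ _ 0 _ _ _ (spsi 1%N)).
  have -> : 'D_(basis3 R j, 0) (fun z => c ^+ 2 * psi (parabolic c^-1 z)) (T z) =
     c ^+ 2 * 'D_(basis3 R j, 0) (psi \o parabolic c^-1) (T z).
    have d : derivable (psi \o parabolic c^-1) (T z) (basis3 R j, 0).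
      by apply: (derivable_affine SL); exact: dpsi.
    exact: (deriveMl (c ^+ 2) d).
  rewrite (@derive_affine R _ _ _ _ SL psi (T z) (basis3 R j, 0)).
 rewrite (parabolicK cn0).
  have -> : parabolic c^-1 (basis3 R j, 0) = c^-1 *: ((basis3 R j, 0) : spacetime R).
    by rewrite /parabolic /= mulr0; congr pair; rewrite /= scaler0.
  by rewrite derive_scalev // expr2 mulrA -(mulrA c c) mulfV ?mulr1.
have cchi := Cn_continuous (chi_smooth 0%N).
have cdchi : continuous (dx j chi).
  exact: (@Cn_continuous _ _ 0 _ (@Cn_derive _ _ 0 _ (basis3 R j,
      0) (chi_smooth 1%N))).
have [mf _] := lf; have [mg _] := lg.
have c50 : c ^+ 5 != 0 by rewrite expf_neq0.
(* Changing variables in the identity for [f] puts the Jacobian c^5 on both sides; the goal is given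
   the same shape. *)
apply: (mulfI c50); rewrite mulrN.
have := fg chi chi_test.
rewrite (@Rintegral_Q1_parabolic (fun z => f z * dx j chi z)); last 2 first.
- apply: measurable_funM => //.
  by apply: measurable_funTS; exact: continuous_measurable31.
- move=> z zQ; rewrite dxchiT (_ : dx j psi z = 0) ?mulr0//.
  by apply: supp_out => /supp_deriv /sQ.
rewrite (@Rintegral_Q1_parabolic (fun z => g z * chi z)); last 2 first.
- apply: measurable_funM => //.
  by apply: measurable_funTS; exact: continuous_measurable31.
- move=> z zQ; rewrite chiT (_ : psi z = 0) ?mulr0 ?mulr0//.
  by apply: supp_out => /sQ.
have E1 : \int[mu]_(z in @Q1 R) (f' z * dx j psi z) =
    \int[mu]_(z in @Q1 R) (f (T z) * dx j chi (T z)).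
  by apply: eq_Rintegral => z /set_mem zQ; rewrite dxchiT f'E // mulrCA mulrA.
have E2 : \int[mu]_(z in @Q1 R) (c ^+ 2 * g (parabolic c z) * psi z) =
    \int[mu]_(z in @Q1 R) (g (T z) * chi (T z)).
  by apply: eq_Rintegral => z _; rewrite chiT mulrCA mulrA.
by move=> H; rewrite E1 E2; exact: H.
Qed.

End rescaling.
End weak_derivative.

(** * Derivatives of the cutoff *)

Section cutoff.
Context {R : realType}.
Implicit Types (chi : space3 R -> R) (theta : R -> R).

Let derivable_fst chi (z v : spacetime R) : derivable chi z.1 v.1 ->
  derivable (fun w : spacetime R => chi w.1) z v.
Proof. by move=> d; apply: (@derivable_affine R (spacetime R) _ fst fst). Qed.

Let derivable_snd theta (z v : spacetime R) : derivable theta z.2 v.2 ->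
  derivable (fun w : spacetime R => theta w.2) z v.
Proof. by move=> d; apply: (@derivable_affine R (spacetime R) _ snd snd). Qed.

Lemma derive_cutoff chi theta (z v : spacetime R) :
  derivable chi z.1 v.1 -> derivable theta z.2 v.2 ->
  'D_v (cutoff chi theta) z =
    theta z.2 * 'D_(v.1) chi z.1 + chi z.1 * 'D_(v.2) theta z.2.
Proof.
move=> dchi dtheta.
have := deriveM (derivable_snd dtheta) (derivable_fst dchi).
have -> : 'D_v (fun w : spacetime R => chi w.1) z = 'D_(v.1) chi z.1.
  exact: (@derive_affine R (spacetime R) _ fst fst).
have -> : 'D_v (fun w : spacetime R => theta w.2) z = 'D_(v.2) theta z.2.
  exact: (@derive_affine R (spacetime R) _ snd snd).
exact.
Qed.

Lemma dx_cutoff chi theta i z : (forall y v, derivable chi y v) ->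
  dx i (cutoff chi theta) z = cutoff (grad3 chi ^~ i) theta z.
Proof.
move=> dchi; rewrite /dx derive_cutoff//; last exact: derivable0.
by rewrite derive0 mulr0 addr0.
Qed.

Lemma dt_cutoff chi theta z : (forall s v, derivable theta s v) ->
  dt (cutoff chi theta) z = 'D_1 theta z.2 * chi z.1.
Proof.
move=> dtheta; rewrite /dt derive_cutoff//; last exact: derivable0.
by rewrite derive0 mulr0 add0r mulrC.
Qed.

Lemma lapx_cutoff chi theta z : smooth chi ->
  lapx (cutoff chi theta) z = theta z.2 * lap3 chi z.1.
Proof.
move=> schi; rewrite /lapx /lap3 mulr_sumr; apply: eq_bigr => i _.
have -> : dx i (cutoff chi theta) = cutoff (grad3 chi ^~ i) theta.
  by apply/funext => w; apply: dx_cutoff => y v;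
      exact: (@Cn_derivable _ _ 0 _ _ _ (schi 1%N)).
rewrite dx_cutoff // => y v.
exact: (@Cn_derivable _ _ 0 _ _ _ (@Cn_derive _ _ 1 _ (basis3 R i) (schi 2%N))).
Qed.

(** The 2 is a convenient bound for the square root of 3. *)
Lemma enorm_le (v : 'I_3 -> R) (m : R) : (forall i, `|v i| <= m) -> enorm v <= 2 * m.
Proof.
move=> vm; have m0 : 0 <= m by apply: le_trans (vm ord0).
rewrite /enorm -(@ler_sqr R) ?nnegrE ?sqrtr_ge0 ?mulr_ge0//.
rewrite sqr_sqrtr; last by apply: sumr_ge0 => i _; exact: sqr_ge0.
have v2 i : v i ^+ 2 <= m ^+ 2 by rewrite -real_normK ?num_real// lerXn2r ?nnegrE.
rewrite !big_ord_recl big_ord0 addr0.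
have := v2 ord0; have := v2 (lift ord0 ord0); have := v2 (lift ord0 (lift ord0 ord0)).
nra.
Qed.

Lemma smooth_grad3 chi i : smooth chi -> smooth (grad3 chi ^~ i).
Proof. by move=> schi n; exact: (@Cn_derive _ _ n _ (basis3 R i) (schi n.+1)). Qed.

Lemma grad3_out chi y i : ~ A_cut chi y -> grad3 chi y i = 0.
Proof.
move=> nA; apply/eqP/negPn/negP => g; apply: nA; left.
by apply: subset_closure; exists i.
Qed.

Lemma lap3_out chi y : ~ A_cut chi y -> lap3 chi y = 0.
Proof. by move=> nA; apply: supp_out => s; apply: nA; right. Qed.

(** Derivatives of [chi] vanish off its support, which is closed, so taking closures leads no
    further. This keeps the slab over [A_cut chi] inside [Q1]. *)
Lemma A_cut_subset chi : A_cut chi `<=` Omega_cut chi.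
Proof.
have E : closure (Omega_cut chi) = Omega_cut chi.
  by apply/esym/closure_id; exact: closed_closure.
have sO i : supp (grad3 chi ^~ i) `<=` Omega_cut chi by exact: supp_deriv.
move=> y [|]; rewrite -E; apply: closure_subset => {}y /=.
  by move=> [i gi]; apply: (sO i); exact: subset_closure.
move=> l; apply: contrapT => ny; move: l; rewrite /lap3 big1 ?eqxx// => i _.
have := @supp_out R _ (fun y => 'D_(basis3 R i) (grad3 chi ^~ i) y) y; apply.
by move=> h; apply: ny; exact: (sO i _ (supp_deriv h)).
Qed.

(** For the time factor, which may be unbounded outside the window: the bound comes from the closed
    interval. *)
Lemma continuous_bounded_itv theta (a b : R) : continuous theta ->
  exists2 M : R, 0 <= M & forall s, s \in `]a, b[ -> `|theta s| <= M.
Proof.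
move=> ct; have [ab|ba] := leP a b; last first.
  exists 0 => // s; rewrite in_itv /= => /andP[/lt_trans h /h].
  by move=> /(lt_trans ba); rewrite ltxx.
have cn : {within `[a, b], continuous (fun s => `|theta s|)}.
  apply: continuous_subspaceT => x; apply: continuous_comp; first exact: ct.
  exact: norm_continuous.
have [c _ fc] := EVT_max ab cn.
exists `|theta c| => // s sab; apply: fc; exact: subset_itv_oo_cc.
Qed.

Lemma uniform_bound (I : finType) (T : Type) (F : I -> T -> R) :
  (forall i, exists2 N : R, 0 <= N & forall y, `|F i y| <= N) ->
  exists2 N : R, 0 <= N & forall i y, `|F i y| <= N.
Proof.
move=> H; have /choice[N HN] : forall i, exists N : R, 0 <= N /\ forall y,
    `|F i y| <= N.
  by move=> i; have [N N0 FN] := H i; exists N.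
exists (\sum_i N i); first by apply: sumr_ge0 => i _; case: (HN i).
move=> i y; apply: le_trans ((HN i).2 y) _; rewrite (bigD1 i)//= lerDl.
by apply: sumr_ge0 => j _; case: (HN j).
Qed.

Lemma cutoff_bounds chi theta : Ccinfty (@eball R 1) chi -> smooth theta ->
  exists2 M : R, 0 <= M & forall z, Q1 z ->
  [/\ `|dt (cutoff chi theta) z| + `|lapx (cutoff chi theta) z| <=
        M * (\1_(Omega_cut chi) z.1 + \1_(A_cut chi) z.1),
      enorm (fun i => dx i (cutoff chi theta) z) <= M * \1_(A_cut chi) z.1 &
      `|cutoff chi theta z| <= M * \1_(Omega_cut chi) z.1].
Proof.
move=> [schi cchi _] sth.
have [N0 N00 chiN] := compact_supp_bounded (Cn_continuous (schi 0%N)) cchi.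
have grad_bd i : exists2 N : R, 0 <= N & forall y, `|grad3 chi y i| <= N.
  apply: compact_supp_bounded; first exact: Cn_continuous (smooth_grad3 i schi 0%N).
  apply: subclosed_compact cchi _; first exact: closed_closure.
  exact: supp_deriv.
have hess_bd i : exists2 N : R, 0 <= N & forall y,
    `|'D_(basis3 R i) (grad3 chi ^~ i) y| <= N.
  apply: compact_supp_bounded;
      first exact: Cn_continuous (smooth_grad3 i (smooth_grad3 i schi) 0%N).
  apply: subclosed_compact cchi _; first exact: closed_closure.
  by apply: subset_trans (@supp_deriv _ _ _ _) (@supp_deriv _ _ _ _).
have [T0 T00 thT] := continuous_bounded_itv (-1) 0 (Cn_continuous (sth 0%N)).
have [T1 T10 dthT] := continuous_bounded_itv (-1) 0 (Cn_continuous (@Cn_derive _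
    _ 0 _ (1 : R) (sth 1%N))).
have [g g0 gN] := uniform_bound grad_bd.
have [h h0 hN'] := uniform_bound hess_bd.
have hN y : `|lap3 chi y| <= h *+ 3.
  rewrite /lap3; apply: le_trans (ler_norm_sum _ _ _) _.
  by rewrite -[in X in _ <= X](card_ord 3) -sumr_const; apply: ler_sum => i _;
      exact: hN'.
have h30 : 0 <= h *+ 3 by rewrite mulrn_wge0.
(* One constant for all estimates. [N0], [g], [h] bound [chi], its first and its pure second
   derivatives; [T0], [T1] bound [theta] and its derivative on the window. The 3 counts the terms of
   the Laplacian and the 2 is that of [enorm_le]. *)
pose M := T1 * N0 + T0 * (h *+ 3) + T0 * (2 * g) + T0 * N0.
exists M; first by rewrite !addr_ge0 ?mulr_ge0 ?addr_ge0.
have [M1 M2 M3 M4] : [/\ T1 * N0 <= M, T0 * (h *+ 3) <= M,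
    T0 * (2 * g) <= M & T0 * N0 <= M].
  have p1 : 0 <= T1 * N0 by rewrite mulr_ge0.
  have p2 : 0 <= T0 * (h *+ 3) by rewrite mulr_ge0 ?addr_ge0.
  have p3 : 0 <= T0 * (2 * g) by rewrite !mulr_ge0 ?addr_ge0.
  have p4 : 0 <= T0 * N0 by rewrite mulr_ge0.
  by rewrite /M; split; lra.
move=> [y s] [/= _ zs].
have dth t v : derivable theta t v by exact: (@Cn_derivable _ _ 0 _ _ _ (sth 1%N)).
have dchi w v : derivable chi w v by exact: (@Cn_derivable _ _ 0 _ _ _ (schi 1%N)).
have E1 : `|dt (cutoff chi theta) (y, s)| <= M * \1_(Omega_cut chi) y.
  rewrite dt_cutoff //= indicE; have [yO|yO] := boolP (y \in Omega_cut chi).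
    by rewrite mulr1 normrM (le_trans _ M1)// ler_pM// dthT.
  rewrite mulr0 (_ : chi y = 0) ?mulr0 ?normr0//.
  by apply: supp_out; move: yO; rewrite notin_setE.
have E2 : `|lapx (cutoff chi theta) (y, s)| <= M * \1_(A_cut chi) y.
  rewrite lapx_cutoff //= indicE; have [yO|yO] := boolP (y \in A_cut chi).
    by rewrite mulr1 normrM (le_trans _ M2)// ler_pM// thT.
  rewrite mulr0 lap3_out ?mulr0 ?normr0//.
  by move: yO; rewrite notin_setE.
split; first by rewrite mulrDr lerD.
- rewrite indicE; have [yO|yO] := boolP (y \in A_cut chi).
    rewrite mulr1 (le_trans _ M3)// mulrCA; apply: enorm_le => i.
    by rewrite dx_cutoff// normrM ler_pM// thT.
  rewrite mulr0 /enorm big1 ?sqrtr0// => i _;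
      rewrite dx_cutoff// /cutoff /= grad3_out ?mulr0 ?expr0n//.
  by move: yO; rewrite notin_setE.
- rewrite /cutoff /= indicE; have [yO|yO] := boolP (y \in Omega_cut chi).
    by rewrite mulr1 normrM (le_trans _ M4)// ler_pM// thT.
  rewrite mulr0 (_ : chi y = 0) ?mulr0 ?normr0//.
  by apply: supp_out; move: yO; rewrite notin_setE.
Qed.

End cutoff.

(** * Leakage estimates *)

(** After extension by 0 this is Tonelli with the second variable outermost: the slice at [s] is the
    extended inner integrand for [s] in [B], and 0 otherwise. *)
Lemma tonelli_rectangle d1 d2 (T1 : measurableType d1) (T2 : measurableType d2)
    (R : realType) (m1 : {sigma_finite_measure set T1 -> \bar R})
    (m2 : {sigma_finite_measure set T2 -> \bar R}) (A : set T1) (B : set T2)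
    (F : T1 * T2 -> \bar R) :
  measurable A -> measurable B -> measurable_fun (A `*` B) F ->
  (forall z, (A `*` B) z -> 0 <= F z)%E ->
  (\int[m2]_(s in B) \int[m1]_(y in A) F (y, s) =
   \int[m1 \x m2]_(z in A `*` B) F z)%E.
Proof.
move=> mA mB mF F0; have mAB : measurable (A `*` B) by exact: measurableX.
rewrite [RHS]integral_mkcond fubini_tonelli2; last 2 first.
- exact/(measurable_restrictT _ mAB).
- by move=> z; rewrite patchE; case: ifPn => // /set_mem; exact: F0.
rewrite [LHS]integral_mkcond; congr integral; apply/funext => s.
rewrite /fubini_G {1}/patch; case: ifPn => sB.
  rewrite [LHS]integral_mkcond; congr integral; apply/funext => y; rewrite /patch.
  by rewrite in_setX /= sB andbT.
by rewrite integral0_eq // => y _; rewrite /patch in_setX /= (negbTE sB) andbF.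
Qed.

Section fields.
Context {R : realType}.
Local Notation mu := (leb31 R).
Implicit Types (u : vector_field R) (p : scalar_field R) (G : tensor_field R).

Lemma tonelli_leb31 (A : set (borel3 R)) (B : set (measurableTypeR R))
    (F : borel31 R -> \bar R) :
  measurable A -> measurable B -> measurable_fun (A `*` B) F ->
  (forall z, (A `*` B) z -> 0 <= F z)%E ->
  (\int[leb1 R]_(s in B) \int[leb3 R]_(y in A) F (y, s) =
   \int[mu]_(z in A `*` B) F z)%E.
Proof.
move=> mA mB mF F0.
exact: (@tonelli_rectangle _ _ _ _ R
  (product_sigma_finite_measure (product_sigma_finite_measure (@lebesgue_measure
      R) (@lebesgue_measure R)) (@lebesgue_measure R))
  (@lebesgue_measure R) A B F mA mB mF F0).
Qed.

Lemma Lp_on_measurable d (T : measurableType d) (m : {measure set T -> \bar R})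
    (D : set T) q (f : T -> R) : measurable D -> Lp_on m D q f -> measurable_fun D f.
Proof.
move=> mD /andP[+ _]; rewrite inE => mf.
exact/(measurable_restrictT _ mD).
Qed.

Lemma measurable_vnorm (D : set (borel31 R)) u :
  (forall i, measurable_fun D (u i : borel31 R -> R)) ->
  measurable_fun D (vnorm u : borel31 R -> R).
Proof.
move=> mu'; apply: (measurableT_comp (f := @Num.sqrt R)).
  exact: continuous_measurable_fun (@sqrt_continuous R).
by apply: measurable_sum => i; apply: measurable_funX.
Qed.

Lemma measurable_tnormsq (D : set (borel31 R)) G :
  (forall i j, measurable_fun D (G i j : borel31 R -> R)) ->
  measurable_fun D (tnormsq G : borel31 R -> R).
Proof.
move=> mG; apply: measurable_sum => i; apply: measurable_sum => j.
exact: measurable_funX.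
Qed.

Lemma vnorm_ge0 u z : 0 <= vnorm u z.
Proof. exact: sqrtr_ge0. Qed.

Lemma tnormsq_ge0 G z : 0 <= tnormsq G z.
Proof. by apply: sumr_ge0 => i _; apply: sumr_ge0 => j _; exact: sqr_ge0. Qed.

End fields.

(** Nonnegativity gives additivity and monotonicity of the extended integral, so infinite values are
    allowed on both sides. *)
Lemma le_integral3 d (T : measurableType d) (R : realType)
    (m : {measure set T -> \bar R}) (D : set T) (K : R) (f1 f2 f3 F1 F2 : T -> R) :
  measurable D ->
  measurable_fun D f1 -> measurable_fun D f2 -> measurable_fun D f3 ->
  measurable_fun D F1 -> measurable_fun D F2 -> 0 <= K ->
  (forall x, D x -> 0 <= f1 x) -> (forall x, D x -> 0 <= f2 x) ->
  (forall x, D x -> 0 <= f3 x) -> (forall x, D x -> 0 <= F1 x) ->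
  (forall x, D x -> 0 <= F2 x) ->
  (forall x, D x -> f1 x + f2 x + 2 * f3 x <= K * (F1 x + F2 x)) ->
  (\int[m]_(x in D) (f1 x)%:E + \int[m]_(x in D) (f2 x)%:E +
     2%:E * \int[m]_(x in D) (f3 x)%:E <=
   K%:E * (\int[m]_(x in D) (F1 x)%:E + \int[m]_(x in D) (F2 x)%:E))%E.
Proof.
move=> mD m1 m2 m3 M1 M2 K0 f10 f20 f30 F10 F20 fF.
have m3' : measurable_fun D (fun x => 2 * f3 x) by exact: measurable_funM.
have m12 : measurable_fun D (fun x => f1 x + f2 x) by exact: measurable_funD.
have m123 : measurable_fun D (fun x => f1 x + f2 x + 2 * f3 x) by exact:
    measurable_funD.
have M12 : measurable_fun D (fun x => F1 x + F2 x) by exact: measurable_funD.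
have M12' : measurable_fun D (fun x => K * (F1 x + F2 x)) by exact: measurable_funM.
have f120 x : D x -> 0 <= f1 x + f2 x by move=> Dx; rewrite addr_ge0 ?f10 ?f20.
have F120 x : D x -> 0 <= F1 x + F2 x by move=> Dx; rewrite addr_ge0 ?F10 ?F20.
have f30' x : D x -> 0 <= 2 * f3 x by move=> Dx; rewrite mulr_ge0 ?f30.
rewrite -ge0_integralZl//; [|exact/measurable_EFinP..].
rewrite -ge0_integralD//; [|exact/measurable_EFinP..].
rewrite -ge0_integralD//; [|exact/measurable_EFinP..].
rewrite -ge0_integralD//; [|exact/measurable_EFinP..].
rewrite -ge0_integralZl//; [|exact/measurable_EFinP..].
apply: ge0_le_integral => //; try exact/measurable_EFinP.
by move=> x Dx; rewrite lee_fin addr_ge0 ?f120 ?f30'.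
Qed.

(** * The leakage bounded by integrals over the supports of the cutoff *)

Section leakage.
Context {R : realType}.
Local Notation mu := (leb31 R).
Variables (chi : space3 R -> R) (theta : R -> R).
Hypothesis chi_Cc : Ccinfty (@eball R 1) chi.
Hypothesis theta_smooth : smooth theta.

Local Notation phi := (cutoff chi theta).
Local Notation Ioo := (`]-1, 0[%classic : set (measurableTypeR R)).

Let mQ1 : measurable (@Q1 R : set (borel31 R)).
Proof. exact: open_measurable31 open_Q1. Qed.

Lemma closed_A_cut : closed (A_cut chi).
Proof. by apply: closedU; exact: closed_closure. Qed.

Lemma measurable_slab (A : set (space3 R)) : closed A ->
  measurable (A `*` Ioo : set (borel31 R)).
Proof.
by move=> cA; apply: measurableX; [exact: closed_measurable3|exact: measurable_itv].
Qed.

Lemma slab_Q1 (A : set (space3 R)) : A `<=` Omega_cut chi -> A `*` Ioo `<=` @Q1 R.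
Proof. by case: chi_Cc => _ _ sO AO [y s] [/= Ay sI]; split => //; exact/sO/AO. Qed.

Lemma smooth_cutoff : smooth phi.
Proof.
case: chi_Cc => schi _ _ n; apply: CnM.
  apply: (@Cn_affine R (spacetime R) _ snd snd) => //.
  by move=> z; exact: cvg_snd.
apply: (@Cn_affine R (spacetime R) _ fst fst) => //.
by move=> z; exact: cvg_fst.
Qed.

Let measurable_derive n (f : scalar_field R) (v : spacetime R) (D : set (borel31 R)) :
  Cn n.+1 f -> measurable_fun D ((fun z => 'D_v f z) : borel31 R -> R).
Proof.
move=> cf; apply: measurable_funTS; apply: continuous_measurable31.
exact: (@Cn_continuous _ _ n _ (@Cn_derive _ _ n _ v cf)).
Qed.

Lemma Leak_phi_le : exists2 K : R, 0 <= K & forall u p,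
  (forall i, measurable_fun (@Q1 R : set (borel31 R)) (u i : borel31 R -> R)) ->
  measurable_fun (@Q1 R : set (borel31 R)) (p : borel31 R -> R) ->
  (forall i j, measurable_fun (@Q1 R : set (borel31 R))
     (weak_grad u i j : borel31 R -> R)) ->
  (Leak_phi phi u p <= K%:E *
    (\int[mu]_(z in Omega_cut chi `*` Ioo)
       (vnorm u z ^+ 2 + tnormsq (weak_grad u) z)%:E +
     \int[mu]_(z in A_cut chi `*` Ioo)
       (vnorm u z ^+ 2 + vnorm u z ^+ 3 + `|p z| * vnorm u z)%:E))%E.
Proof.
have [M M0 bounds] := cutoff_bounds chi_Cc theta_smooth.
(* The 2 absorbs the coefficients of the pressure flux and of the gradient term. *)
exists (2 * M); first by rewrite mulr_ge0.
move=> u p mu_ mp mG; rewrite /Leak_phi.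
have mv := measurable_vnorm mu_; have mt := measurable_tnormsq mG.
have mphi (D : set (borel31 R)) : measurable_fun D (phi : borel31 R -> R).
  apply: measurable_funTS; apply: continuous_measurable31.
  exact: Cn_continuous (smooth_cutoff 0%N).
have mdt (D : set (borel31 R)) : measurable_fun D (dt phi : borel31 R -> R).
  exact: (@measurable_derive 0 _ _ _ (smooth_cutoff 1%N)).
have mdx i (D : set (borel31 R)) : measurable_fun D (dx i phi : borel31 R -> R).
  exact: (@measurable_derive 0 _ _ _ (smooth_cutoff 1%N)).
have mlap (D : set (borel31 R)) : measurable_fun D (lapx phi : borel31 R -> R).
  apply: measurable_sum => i.
  exact: (@measurable_derive 0 _ _ _ (@Cn_derive _ _ 1 _ _ (smooth_cutoff 2%N))).
have menorm (D : set (borel31 R)) :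
    measurable_fun D ((fun z => enorm (fun i => dx i phi z)) : borel31 R -> R).
  exact: (@measurable_vnorm R D (fun i => dx i phi) (fun i => mdx i D)).
have cA := closed_A_cut; have cO : closed (Omega_cut chi) by exact: closed_closure.
have mv2 : measurable_fun (@Q1 R : set (borel31 R)) (fun z => vnorm u z ^+ 2) by
    exact: measurable_funX.
have mv3 : measurable_fun (@Q1 R : set (borel31 R)) (fun z => vnorm u z ^+ 3) by
    exact: measurable_funX.
have mnp : measurable_fun (@Q1 R : set (borel31 R)) (fun z => `|p z|) by exact:
    measurable_fun_normr.
pose f1 z := vnorm u z ^+ 2 * (`|dt phi z| + `|lapx phi z|).
pose f2 z := (vnorm u z ^+ 3 + 2 * `|p z| * vnorm u z) * enorm (fun i => dx i phi z).
pose f3 z := tnormsq (weak_grad u) z * phi z.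
pose F1 z := vnorm u z ^+ 2 + tnormsq (weak_grad u) z.
pose F2 z := vnorm u z ^+ 2 + vnorm u z ^+ 3 + `|p z| * vnorm u z.
have mf1 : measurable_fun (@Q1 R : set (borel31 R)) (f1 : borel31 R -> R).
  apply: measurable_funM => //; apply: measurable_funD; exact: measurable_fun_normr.
have mf2 : measurable_fun (@Q1 R : set (borel31 R)) (f2 : borel31 R -> R).
  apply: measurable_funM => //; apply: measurable_funD => //.
  by apply: measurable_funM => //; apply: measurable_funM.
have mf3 : measurable_fun (@Q1 R : set (borel31 R)) (f3 : borel31 R -> R).
  exact: measurable_funM.
have mF1 : measurable_fun (@Q1 R : set (borel31 R)) (F1 : borel31 R -> R).
  exact: measurable_funD.
have mF2 : measurable_fun (@Q1 R : set (borel31 R)) (F2 : borel31 R -> R).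
  by apply: measurable_funD; [exact: measurable_funD|exact: measurable_funM].
have v0 z : 0 <= vnorm u z by exact: vnorm_ge0.
have v20 z : 0 <= vnorm u z ^+ 2 by rewrite exprn_ge0.
have v30 z : 0 <= vnorm u z ^+ 3 by rewrite exprn_ge0.
have pv0 z : 0 <= `|p z| * vnorm u z by rewrite mulr_ge0.
have t0 z : 0 <= tnormsq (weak_grad u) z by exact: tnormsq_ge0.
have f10 z : 0 <= f1 z by rewrite mulr_ge0 ?addr_ge0.
have f20 z : 0 <= f2 z by rewrite mulr_ge0 ?addr_ge0 ?mulr_ge0 ?sqrtr_ge0.
have F10 z : 0 <= F1 z by rewrite addr_ge0.
have F20 z : 0 <= F2 z by rewrite !addr_ge0.
(* The cutoff may change sign, so [f3] is replaced by its absolute value before the nonnegative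
   estimates apply. *)
have f3le : (\int[mu]_(z in @Q1 R) (f3 z)%:E <= \int[mu]_(z in @Q1 R) (`|f3 z|)%:E)%E.
  apply: le_trans (lee_abs _) _.
  by apply: (le_abse_integral mu mQ1); exact/measurable_EFinP.
(* Indicators bring the slab integrals to the common domain [Q1], where a pointwise inequality can
   be integrated. *)
have indic_slab (S : set (space3 R)) (F : borel31 R -> R) : S `<=` Omega_cut chi ->
    (\int[mu]_(z in S `*` Ioo) (F z)%:E = \int[mu]_(z in @Q1 R) (F z * \1_S
        z.1)%:E)%E.
  move=> SO; rewrite [LHS]integral_mkcond [RHS]integral_mkcond; congr integral.
  apply/funext => z; rewrite /patch indicE.
  have [zS|zS] := boolP (z \in S `*` Ioo).
    rewrite mem_set; last by apply: (slab_Q1 SO); exact: set_mem.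
    by rewrite mem_set ?mulr1//; case: (set_mem zS).
  case: ifPn => // zQ; rewrite [z.1 \in S](_ : _ = false) ?mulr0//.
  apply/negP => zS1; move: zS; rewrite notin_setE; apply; split; first exact: set_mem.
  by have [] := set_mem zQ.
have mind (S : set (space3 R)) : closed S ->
    measurable_fun (@Q1 R : set (borel31 R)) ((fun z => \1_S z.1) : borel31 R -> R).
  move=> cS; apply: (@measurableT_comp _ _ _ _ _ _ (\1_S : borel3 R ->
      R) _ (fst : borel31 R -> borel3 R)).
    by apply: (@measurable_indic _ _ R); exact: closed_measurable3.
  exact: measurable_funTS.
rewrite (indic_slab _ F1)// (indic_slab _ F2); last exact: A_cut_subset.
apply: (@le_trans _ _ (\int[mu]_(z in @Q1 R) (f1 z)%:E + \int[mu]_(z in @Q1 R)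
    (f2 z)%:E +
   2%:E * \int[mu]_(z in @Q1 R) (`|f3 z|)%:E)%E).
  by rewrite leeD2l// lee_wpmul2l.
have ind0 (S : set (space3 R)) y : 0 <= \1_S y :> R by rewrite indicE ler0n.
apply: le_integral3 => //.
- exact: measurable_fun_normr.
- by apply: measurable_funM => //; exact: mind.
- by apply: measurable_funM => //; exact: mind.
- by rewrite mulr_ge0.
- by move=> z _; rewrite mulr_ge0.
- by move=> z _; rewrite mulr_ge0.
move=> z /bounds[b1 b2 b3].
have o0 := ind0 (Omega_cut chi) z.1; have a0 := ind0 (A_cut chi) z.1.
set o := \1_(Omega_cut chi) z.1 in b1 b3 o0 *;
    set a := \1_(A_cut chi) z.1 in b1 b2 a0 *.
have e1 := ler_wpM2l (v20 z) b1.
have e2 : f2 z <= (vnorm u z ^+ 3 + 2 * `|p z| * vnorm u z) * (M * a).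
  by rewrite ler_wpM2l // addr_ge0 // -mulrA mulr_ge0.
have e3 : `|f3 z| <= tnormsq (weak_grad u) z * (M * o).
  by rewrite normrM (ger0_norm (t0 z)) ler_wpM2l.
(* The three quantities [c1], [c2], [c3] are exactly what the factor 2 gives in excess; with them
   the inequality is linear in the products. *)
have c1 : 0 <= vnorm u z ^+ 2 * (M * o) by rewrite !mulr_ge0.
have c2 : 0 <= vnorm u z ^+ 2 * (M * a) by rewrite !mulr_ge0.
have c3 : 0 <= vnorm u z ^+ 3 * (M * a) by rewrite !mulr_ge0.
rewrite -/(f1 z) in e1; move: e1 e2 e3 c1 c2 c3; rewrite /F1 /F2.
move: (f1 z) (f2 z) `|f3 z| (vnorm u z) (tnormsq _ z) `|p z| => x1 x2 x3 v t q.
lra.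
Qed.

End leakage.

(** * Weak gradients and slab integrals under rescaling *)

Section rescaling.
Context {R : realType}.
Local Notation mu := (leb31 R).
Variables (c : R) (c0 : 0 < c) (c1 : c <= 1).
Local Notation T := (parabolic c : borel31 R -> borel31 R).
Local Notation Ioo := (`]-1, 0[%classic : set (measurableTypeR R)).

Let mQ1 : measurable (@Q1 R : set (borel31 R)).
Proof. exact: open_measurable31 open_Q1. Qed.

Lemma weak_gradP (u : vector_field R) :
  (exists G, is_weak_grad (@Q1 R) u G) -> is_weak_grad (@Q1 R) u (weak_grad u).
Proof. by move=> [G uG]; exact: (xgetPex _ (ex_intro _ G uG)). Qed.

(** A chosen weak derivative is locally integrable, hence measurable, and the dummy value is
    constant; the rescaled field is thus covered before anything is known of its gradient. *)
Lemma measurable_weak_grad (u : vector_field R) i j :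
  measurable_fun (@Q1 R : set (borel31 R)) (weak_grad u i j : borel31 R -> R).
Proof.
have [/weak_gradP uG|nG] := pselect (exists G, is_weak_grad (@Q1 R) u G).
  by have [_ [+ _] _] := uG i j.
rewrite /weak_grad xgetPN; first exact: measurable_cst.
by move=> G uG; apply: nG; exists G.
Qed.

(* An inequality only, since [weak_grad u'] is the dummy value 0 if [u'] turns out
   to have no weak gradient. *)
Lemma tnormsq_weak_grad_parabolic (u u' : vector_field R) :
  (exists G, is_weak_grad (@Q1 R) u G) ->
  (forall i z, Q1 z -> u' i z = c * u i (parabolic c z)) ->
  {ae mu, forall z, Q1 z ->
    tnormsq (weak_grad u') z <= tnormsq (weak_grad u) (parabolic c z)}.
Proof.
move=> /weak_gradP uG u'E.
have [/weak_gradP uG'|nG] := pselect (exists G, is_weak_grad (@Q1 R) u' G);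
    last first.
  apply: aeW => z _; rewrite {1}/weak_grad xgetPN; last by move=> G uG';
      apply: nG; exists G.
  rewrite (_ : tnormsq _ z = 0) ?tnormsq_ge0// /tnormsq big1// => i _.
  by rewrite big1// => j _; rewrite expr0n.
have H (ij : 'I_3 * 'I_3) : {ae mu, forall z, Q1 z ->
    weak_grad u' ij.1 ij.2 z = c ^+ 2 * weak_grad u ij.1 ij.2 (parabolic c z)}.
  apply: (is_weak_dx_unique open_Q1 (uG' ij.1 ij.2)).
  exact: (is_weak_dx_parabolic c0 c1 (uG _ _) (u'E _)).
have := @filter_forall _ _ _ _ (ae_filter_ringOfSetsType mu) H.
apply: (@filterS _ _ (ae_filter_ringOfSetsType mu)) => z Hz zQ.
apply: ler_sum => i _; apply: ler_sum => j _.
rewrite (Hz (i, j) zQ) /= exprMn ler_piMl ?sqr_ge0//.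
by rewrite -exprM exprn_ile1 // ltW.
Qed.

Lemma vnorm_parabolic (u u' : vector_field R) z :
  (forall i, u' i z = c * u i (parabolic c z)) ->
  vnorm u' z = c * vnorm u (parabolic c z).
Proof.
move=> u'E; rewrite /vnorm /enorm.
under eq_bigr do rewrite u'E exprMn.
by rewrite -mulr_sumr sqrtrM ?sqr_ge0 // sqrtr_sqr ger0_norm // ltW.
Qed.

(** As a preimage, the dilated set inherits closedness by continuity. *)
Lemma dilE (S : set (space3 R)) : dil c S = (fun y => c^-1 *: y) @^-1` S.
Proof.
apply/seteqP; split => [_ [y Sy <-]|y Sy] /=.
  by rewrite scalerA mulVf ?gt_eqF// scale1r.
by exists (c^-1 *: y) => //; rewrite scalerA mulfV ?gt_eqF// scale1r.
Qed.

(** The region of integration is the image under [T] of the slab over [S], so Tonelli and the change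
    of variables bring the integral back to unit scale. *)
Lemma integral_dilated_slab (S : set (space3 R)) (F : borel31 R -> R) :
  closed S -> S `<=` eball 1 -> measurable_fun (@Q1 R : set (borel31 R)) F ->
  (forall z, 0 <= F z) ->
  (\int[leb1 R]_(s in `](- c ^+ 2)%R, 0%R[)
     \int[leb3 R]_(y in dil c S) (F (y, s))%:E =
   (c ^+ 5)%:E * \int[mu]_(z in S `*` Ioo) (F (T z))%:E)%E.
Proof.
move=> cS SB mF F0.
have cdS : closed (dil c S).
  rewrite dilE; apply: (@closed_comp _ _ (fun y : space3 R => c^-1 *: y)) => // y _.
  exact: (@scaler_continuous _ _ c^-1 y).
have mdS := closed_measurable3 cdS.
have mI : measurable (`](- c ^+ 2)%R,
    0%R[%classic : set (measurableTypeR R)) by exact: measurable_itv.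
have c20 : 0 < c ^+ 2 by rewrite exprn_gt0.
have TE : T @^-1` (dil c S `*` `](- c ^+ 2)%R, 0%R[) = S `*` Ioo.
  apply/seteqP; split => -[y s];
      rewrite dilE /= !in_itv /= scalerA mulVf ?gt_eqF// scale1r.
    move=> [Sy /andP[s1 s2]]; split => //; apply/andP; split; nra.
  by move=> [Sy /andP[s1 s2]]; split => //; apply/andP; split; nra.
have sub : dil c S `*` `](- c ^+ 2)%R, 0%R[ `<=` @Q1 R.
  move=> z zS; have -> : z = T (parabolic c^-1 z) by rewrite parabolicVK ?gt_eqF.
  apply: parabolic_Q1 => //.
  have : (T @^-1` (dil c S `*` `](- c ^+ 2)%R, 0%R[)) (parabolic c^-1 z).
    change ((dil c S `*` `](- c ^+ 2)%R, 0%R[) (parabolic c (parabolic c^-1 z))).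
    by rewrite parabolicVK ?gt_eqF.
  by rewrite TE => -[Sz Iz]; split => //; exact: SB.
have mF' : measurable_fun (dil c S `*` `](- c ^+ 2)%R,
    0%R[ : set (borel31 R)) (fun z => (F z)%:E).
  by apply/measurable_EFinP; exact: (measurable_funS mQ1 sub mF).
rewrite (tonelli_leb31 mdS mI mF'); last by move=> z _; rewrite lee_fin.
rewrite (ge0_integral_parabolic c0 _ mF'); last 2 first.
- exact: measurableX.
- by move=> z _; rewrite lee_fin.
by rewrite TE.
Qed.

End rescaling.

Theorem proposition5p4 (R : realType)
    (lambda : R) (lambda_gt0 : 0 < lambda) (lambda_lt1 : lambda < 1)
    (chi : space3 R -> R) (chi_Cc : Ccinfty (@eball R 1) chi)
    (chi1 : forall y, @eball R (3 / 4) y -> chi y = 1)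
    (theta : R -> R) (theta_Cc : Ccinfty_time theta) :
  exists C : R,
    forall (I : Type) (k : nat) (u : nat -> vector_field R) (p : nat -> scalar_field R)
           (D : nat -> audit_ledger R I),
      ANS (u k) (p k) (D k) ->
      is_rescaling lambda (u k) (p k) (u k.+1) (p k.+1) ->
      (Leak_phi (cutoff chi theta) (u k.+1) (p k.+1) <=
         C%:E * Leak_step lambda chi (u k) (p k))%E /\
      ((C%:E * Leak_step lambda chi (u k) (p k) <= Delta_loc (D k))%E ->
        loc_admissible (cutoff chi theta) (D k) (u k.+1) (p k.+1)).
Proof.
have [theta_smooth _ _] := theta_Cc.
have lambda_le1 := ltW lambda_lt1.
have [K K0 leak_le] := Leak_phi_le chi_Cc theta_smooth.
(* [K] bounds the leakage at unit scale; [lambda ^- 5] cancels the Jacobian that [Leak_step]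
   acquires when pulled back to that scale. *)
exists (K * lambda ^- 5) => I k u p D hD resc.
suff le_leak : (Leak_phi (cutoff chi theta) (u k.+1) (p k.+1) <=
    (K * lambda ^- 5)%:E * Leak_step lambda chi (u k) (p k))%E.
  by split => // le_Delta; exact: le_trans le_leak le_Delta.
move: (u k) (u k.+1) (p k) (p k.+1) (D k) hD resc => {}u u' {}p p' {}D.
move=> [[uL3 _] [uG _] [pL _] _ _] resc.
have mQ1 : measurable (@Q1 R : set (borel31 R)) := open_measurable31 open_Q1.
have mu_ i : measurable_fun (@Q1 R : set (borel31 R)) (u i : borel31 R -> R).
  exact: Lp_on_measurable (uL3 i).
have mp : measurable_fun (@Q1 R : set (borel31 R)) (p : borel31 R -> R).
  exact: Lp_on_measurable pL.
have u'E i z : Q1 z -> u' i z = lambda * u i (parabolic lambda z).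
  by case: z => Y S zQ; have [] := resc Y S zQ.
have p'E z : Q1 z -> p' z = lambda ^+ 2 * p (parabolic lambda z).
  by case: z => Y S zQ; have [] := resc Y S zQ.
have mT (f : borel31 R -> R) : measurable_fun (@Q1 R : set (borel31 R)) f ->
    measurable_fun (@Q1 R : set (borel31 R)) (fun z => f (parabolic lambda z)).
  by apply: (measurable_fun_parabolic mQ1) => z; exact: parabolic_Q1.
have mu'_ i : measurable_fun (@Q1 R : set (borel31 R)) (u' i : borel31 R -> R).
  apply: (@eq_measurable_fun _ _ _ _ _ (fun z => lambda * u i (parabolic lambda z))).
    by move=> z /set_mem zQ; rewrite u'E.
  by apply: measurable_funM => //; exact: mT.
have mp' : measurable_fun (@Q1 R : set (borel31 R)) (p' : borel31 R -> R).
  apply: (@eq_measurable_fun _ _ _ _ _ (fun z => lambda ^+ 2 * p (parabolic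
      lambda z))).
    by move=> z /set_mem zQ; rewrite p'E.
  by apply: measurable_funM => //; exact: mT.
have mG := @measurable_weak_grad R u; have mG' := @measurable_weak_grad R u'.
apply: le_trans (leak_le u' p' mu'_ mp' mG') _.
have mv := measurable_vnorm mu_; have mt := measurable_tnormsq mG.
have mv' := measurable_vnorm mu'_; have mt' := measurable_tnormsq mG'.
have v0 w z : 0 <= vnorm w z :> R by exact: vnorm_ge0.
have t0 G z : 0 <= tnormsq G z :> R by exact: tnormsq_ge0.
pose F1 z := vnorm u z ^+ 2 + tnormsq (weak_grad u) z.
pose F2 z := vnorm u z ^+ 2 + vnorm u z ^+ 3 + `|p z| * vnorm u z.
have F10 z : 0 <= F1 z by rewrite addr_ge0 ?exprn_ge0.
have F20 z : 0 <= F2 z by rewrite !addr_ge0 ?exprn_ge0 ?mulr_ge0.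
have mF1 : measurable_fun (@Q1 R : set (borel31 R)) (F1 : borel31 R -> R).
  by apply: measurable_funD => //; exact: measurable_funX.
have mF2 : measurable_fun (@Q1 R : set (borel31 R)) (F2 : borel31 R -> R).
  apply: measurable_funD; first by apply: measurable_funD; exact: measurable_funX.
  by apply: measurable_funM => //; exact: measurable_fun_normr.
have [_ _ sO] := chi_Cc.
have cO : closed (Omega_cut chi) by exact: closed_closure.
have cA := closed_A_cut (chi := chi).
have sA := subset_trans (@A_cut_subset R chi) sO.
have step := integral_dilated_slab lambda_gt0 lambda_le1.
rewrite /Leak_step (step _ F1 cO sO mF1 F10) (step _ F2 cA sA mF2 F20).
rewrite -ge0_muleDr; [|by apply: integral_ge0 => z _; rewrite lee_fin..].
rewrite muleA -EFinM -mulrA mulVf ?mulr1 ?expf_neq0 ?gt_eqF//.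
apply: lee_wpmul2l; first by rewrite lee_fin.
have QO := slab_Q1 chi_Cc (@subset_refl _ (Omega_cut chi)).
have QA := slab_Q1 chi_Cc (@A_cut_subset R chi).
have mSO := measurable_slab cO; have mSA := measurable_slab cA.
have v'E z : Q1 z -> vnorm u' z = lambda * vnorm u (parabolic lambda z).
  by move=> zQ; apply: vnorm_parabolic => // i; exact: u'E.
have le_pow n x : 0 <= x -> lambda ^+ n * x <= x :> R.
  by move=> x0; rewrite ler_piMl// exprn_ile1// ltW.
apply: leeD.
  (* The gradients are compared only almost everywhere, hence this form of monotonicity. *)
  apply: ae_ge0_le_integral => //.
  - by move=> z _; rewrite lee_fin addr_ge0 ?exprn_ge0.
  - apply/measurable_EFinP; apply: (measurable_funS mQ1 QO).
    by apply: measurable_funD => //; exact: measurable_funX.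
  - by move=> z _; rewrite lee_fin.
  - apply/measurable_EFinP; apply: (measurable_funS mQ1 QO).
    exact: (mT F1).
  have := tnormsq_weak_grad_parabolic lambda_gt0 lambda_le1 uG u'E.
  apply: (@filterS _ _ (ae_filter_ringOfSetsType (leb31 R))) => z Hz zO.
  have zQ := QO _ zO; rewrite lee_fin lerD ?Hz// v'E// exprMn.
  by rewrite le_pow // exprn_ge0.
apply: ge0_le_integral => //.
- by move=> z _; rewrite lee_fin !addr_ge0 ?exprn_ge0 ?mulr_ge0.
- apply/measurable_EFinP; apply: (measurable_funS mQ1 QA).
  apply: measurable_funD; first by apply: measurable_funD; exact: measurable_funX.
  by apply: measurable_funM => //; exact: measurable_fun_normr.
- apply/measurable_EFinP; apply: (measurable_funS mQ1 QA).
  exact: (mT F2).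
move=> z /QA zQ; rewrite lee_fin v'E// p'E// !exprMn.
rewrite normrM (ger0_norm (exprn_ge0 2 (ltW lambda_gt0))).
(* The pressure carries lambda^2 and the velocity lambda; gathered into one power, they are
   discarded by [le_pow]. *)
rewrite (_ : lambda ^+ 2 * _ * _ = lambda ^+ 3 * (`|p (parabolic lambda z)| *
  vnorm u (parabolic lambda z))); last by ring.
by rewrite !lerD ?le_pow ?exprn_ge0 ?mulr_ge0.
Qed.
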